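(* As $n \to \infty$, $r^{\mathrm{bip}}_3(P_n) = (3/2+o(1))n$; that is, $\lim_{n\to\infty} r^{\mathrm{bip}}_3(P_n)/n = 3/2$.
   Context: $P_n$ denotes the path on $n$ vertices. For a bipartite graph $H$ and a positive integer $k$, the $k$-colour bipartite Ramsey number $r^{\mathrm{bip}}_k(H)$ is the least integer $N$ such that every colouring of the edges of the complete bipartite graph $K_{N,N}$ with $k$ colours contains a monochromatic copy of $H$ (as a not necessarily induced subgraph). *)

(* Defs.v *)
From mathcomp Require Import all_boot.

Set Implicit Arguments.
Unset Strict Implicit.
Unset Printing Implicit Defensive.

Record sgraph := SGraph {
  vertex :> finType;
  edge : rel vertex;
  edge_sym : symmetric edge;
  edge_irr : irreflexive edge }.

Record bipgraph := BipGraph {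
  bip_sgraph :> sgraph;
  bip_prop : exists s : bip_sgraph -> bool,
    forall x y : bip_sgraph, edge x y -> s x != s y }.

(* [G] contains a copy of [H] as a not necessarily induced subgraph. *)
Definition contains_copy (G H : sgraph) : bool :=
  [exists f : {ffun H -> G}, injectiveb f &&
     [forall x, forall y, edge x y ==> edge (f x) (f y)]].

Section ColourClass.
Variables (k N : nat).

(* The vertex classes of K_{N,N} are the two copies of 'I_N in 'I_N + 'I_N.
   Its edges are the pairs {inl i, inr j}, so that an edge colouring is an
   arbitrary function of (i, j). *)
Definition bip_colouring := {ffun 'I_N * 'I_N -> 'I_k}.

Definition colour_edge (c : bip_colouring) (a : 'I_k) : rel ('I_N + 'I_N) :=
  fun u v => match u, v with
  | inl i, inr j | inr j, inl i => c (i, j) == a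
  | _, _ => false
  end.

Fact colour_edge_sym c a : symmetric (colour_edge c a).
Proof. by case=> i [] j. Qed.

Fact colour_edge_irr c a : irreflexive (colour_edge c a).
Proof. by case. Qed.

Definition colour_class (c : bip_colouring) (a : 'I_k) : sgraph :=
  SGraph (colour_edge_sym c a) (colour_edge_irr c a).
End ColourClass.

Definition bip_arrows (k : nat) (H : sgraph) (N : nat) : bool :=
  [forall c : bip_colouring k N, exists a : 'I_k,
     contains_copy (colour_class c a) H].

Lemma pigeonhole_class (T U : finType) (F : T -> U) (m : nat) :
  0 < #|U| -> #|U| * m <= #|T| -> exists u, m <= #|[set x | F x == u]|.
Proof.
move=> U_gt0 leUT; apply/existsP; apply: contraLR leUT.
rewrite negb_exists => /forallP ltm; rewrite -ltnNge.
have -> : #|T| = \sum_(u : U) #|[set x | F x == u]|.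
  rewrite -sum1_card (partition_big F predT) //=.
  by apply: eq_bigr => u _; rewrite -sum1_card; apply: eq_bigl => x; rewrite inE.
have [u0 _] := card_gt0P U_gt0.
rewrite -sum_nat_const (bigD1 u0) //= [ltnRHS](bigD1 u0) //= -addSn leq_add //.
  by rewrite ltnNge.
by apply: leq_sum => u _; rewrite ltnW // ltnNge.
Qed.

Lemma set_inj (T : finType) (A : {set T}) (m : nat) :
  m <= #|A| -> exists2 g : 'I_m -> T, injective g & forall i, g i \in A.
Proof.
move=> leA; exists (fun i => enum_val (widen_ord leA i)) => [i j|i].
  by move/enum_val_inj/(congr1 val) => /= eij; apply: val_inj.
exact: enum_valP.
Qed.

Lemma bip_arrows_exists (k : nat) (H : bipgraph) : exists N, bip_arrows k H N.
Proof.
case: k => [|k].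
  by exists 1; apply/forallP => c; case: (c (ord0, ord0)).
pose m := #|H|; pose s := k.+1 * m.
exists (s + k.+1 ^ s * m); set N := (s + _)%N.
have leN : s <= N by rewrite leq_addr.
apply/forallP => c.
pose F (j : 'I_N) := [ffun i : 'I_s => c (widen_ord leN i, j)].
have [||phi le_phi] := @pigeonhole_class _ _ F m.
- by rewrite card_ffun !card_ord expn_gt0.
- by rewrite card_ffun !card_ord leq_addl.
have [||a le_a] := @pigeonhole_class _ _ phi m; rewrite ?card_ord //.
have [g g_inj gP] := set_inj le_a; have [h h_inj hP] := set_inj le_phi.
have col i j : c (widen_ord leN (g i), h j) = a.
  have := gP i; have := hP j; rewrite !inE => /eqP <-.
  by rewrite ffunE => /eqP.
have [t tP] := bip_prop H.
apply/existsP; exists a; apply/existsP.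
exists [ffun x : H => if t x then inl (widen_ord leN (g (enum_rank x)))
                      else inr (h (enum_rank x))].
apply/andP; split.
  apply/injectiveP => x y; rewrite !ffunE.
  case: (t x); case: (t y) => // -[].
    by move=> eg; apply/enum_rank_inj/g_inj/val_inj.
  by move/h_inj/enum_rank_inj.
apply/forallP => x; apply/forallP => y; apply/implyP => /tP.
by rewrite !ffunE; case: (t x); case: (t y) => //= _; rewrite col.
Qed.

Definition bip_ramsey (k : nat) (H : bipgraph) : nat :=
  ex_minn (bip_arrows_exists k H).

Section Path.
Variable n : nat.

Definition path_edge : rel 'I_n :=
  fun i j => (i.+1 == j :> nat) || (j.+1 == i :> nat).

Fact path_edge_sym : symmetric path_edge.
Proof. by move=> i j; rewrite /path_edge orbC. Qed.

Fact path_edge_irr : irreflexive path_edge.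
Proof. by move=> i; rewrite /path_edge orbb gtn_eqF. Qed.

Fact path_bip : exists s : SGraph path_edge_sym path_edge_irr -> bool,
  forall x y : SGraph path_edge_sym path_edge_irr, edge x y -> s x != s y.
Proof.
exists (fun i : 'I_n => odd i) => x y /= /orP[] /eqP <- /=.
  by case: (odd x).
by case: (odd y).
Qed.

(* The path on [n] vertices (not [n] edges). *)
Definition path_graph : bipgraph := BipGraph path_bip.
End Path.

(* Main.v *)
Require Import Defs.
From mathcomp Require Import all_boot all_order all_algebra zify ring lra.

(** Lower bound: colour the edge [(i, j)] of [K_{N,N}], [N <= 3 k], by [i %/ k].
    Every colour class is covered by [k] vertices, so it has no path on
    [2 k + 2] vertices.

    Upper bound. A graph can be made, by deleting few edges, into a disjoint union
    of cut-dense pieces: every cut of a piece has positive density. If a large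
    cut-dense piece stays uncovered by any [n / 2 + o(N)] vertices even up to few
    edges, then it contains a path on [n] vertices. Indeed, by max-flow min-cut
    (Koenig), it contains a dense subgraph with maximum degree [d] and about
    [d n / 2] edges; splitting the vertices at random into layers and applying
    Menger's theorem to them gives disjoint paths of a large constant length
    covering [n] vertices; and these are linked through a reservoir of short
    connectors set aside in advance, chosen greedily so that every pair of
    vertices keeps many connectors.

    So if no colour contains the path, then, up to few junk pairs, every edge
    lies inside a piece of its colour and meets the vertex cover of that piece,
    and all these covers have fewer than [N / 3 - o(N)] vertices. A random sample of
    constant size has no junk pair and inherits the bound on the covers, and an
    exact argument on complete bipartite graphs [K_{3s+1,3s+1}] with covers of
    size at most [s] gives a contradiction. *)

Set Implicit Arguments.
Unset Strict Implicit.
Unset Printing Implicit Defensive.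

(** * Koenig's theorem and disjoint paths in layered graphs *)

(** The ratio 3/2 comes from covering: once [N] slightly exceeds [3 n / 2], covers of about [n / 2]
    vertices stay just below [N / 3], and the exact statement forbids exactly that; all errors must
    fit into this margin. Long paths rest on a balance of constants. Every pair of vertices needs at
    least as many connectors as there are path pieces to link, yet the reservoir must be a small
    fraction of the graph. A random word of constant length connects a given pair with probability
    bounded below, so [O(h)] words can serve every pair [h] times at once. Taking [h] to be a tiny
    constant fraction of the number of vertices keeps the reservoir small, and pieces of a
    correspondingly large constant length are then fewer than [h]. In the sampling the obstacle is
    that the number of components grows with [N] while the sample has constant size. Hence no union
    bound: the squared deviations are summed over all components, and disjointness bounds this sum
    independently of their number. *)

Section Koenig.
Variables (L R : finType) (r : L -> R -> bool).

Definition matching (f : {ffun L -> option R}) : Prop :=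
  (forall x y, f x = Some y -> r x y) /\
  (forall x x' y, f x = Some y -> f x' = Some y -> x = x').

Definition msize (f : {ffun L -> option R}) := #|[set x | f x != None]|.

Definition upd (f : {ffun L -> option R}) x y : {ffun L -> option R} :=
  [ffun z => if z == x then Some y else f z].

Lemma upd_matching f x y :
  matching f -> r x y -> (forall z, f z <> Some y) -> matching (upd f x y).
Proof.
move=> [fr finj] rxy fy; split=> [z w|z z' w]; rewrite !ffunE.
  by case: eqP => [-> [<-] //|_]; apply: fr.
case: eqP => [->|_]; case: eqP => [->|_] //.
- by move=> [<-] /fy.
- by move=> /[swap] -[<-] /fy.
- exact: finj.
Qed.

(** An alternating path with its right vertices contracted: [u] steps to the owner [v] of one of its
    neighbours. *)
Definition alt (f : {ffun L -> option R}) : rel L :=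
  fun u v => [exists y, r u y && (f v == Some y)].

(** Induction from the far end of the path: rematching its last vertex [v] to the free [y] keeps the
    size and frees the old partner [w] of [v], to which the shorter path leads. *)
Lemma augment p : forall f x y,
  matching f -> f x = None -> path (alt f) x p -> uniq (x :: p) ->
  r (last x p) y -> (forall z, f z <> Some y) ->
  exists2 f', matching f' & msize f' = (msize f).+1.
Proof.
elim/last_ind: p => [|p v IH] f x y mf fx.
  move=> _ _ /= rxy fy; exists (upd f x y); first exact: upd_matching.
  rewrite /msize (cardsD1 x) inE ffunE eqxx /= add1n; congr S.
  apply: eq_card => z; rewrite !inE ffunE.
  by case: (z =P x) => [->|//]; rewrite fx.
rewrite rcons_path -rcons_cons rcons_uniq last_rcons.
move=> /andP[pp /existsP[w /andP[rw /eqP fv]]] /andP[vn un] rvy fy.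
have vx : (x == v) = false by apply: contraNF vn => /eqP ->; rewrite mem_head.
have [] := IH (upd f v y) x w (upd_matching mf rvy fy) _ _ un rw.
- by rewrite ffunE vx.
- rewrite (eq_in_path (P := mem (x :: p)) (e' := alt f)) //; last first.
    by apply/allP.
  move=> a b _ bin; rewrite /alt; apply: eq_existsb => z; rewrite ffunE.
  by case: (b =P v) => // ebv; rewrite -ebv bin in vn.
- move=> z; rewrite ffunE; case: eqP => [_ [ewy]|nzv /(mf.2 z v w) -/(_ fv) //].
  by apply: (fy v); rewrite fv ewy.
move=> f' mf' sf'; exists f' => //; rewrite sf'; congr S.
apply: eq_card => z; rewrite !inE ffunE.
by case: (z =P v) => // ->; rewrite fv.
Qed.


Lemma koenig q :
  (exists2 f, matching f & q <= msize f) \/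
  (exists (C : {set L}) (D : {set R}), #|C| + #|D| < q /\ forall x y, r x y -> (x \in C) || (y \in D)).
Proof.
pose mb (f : {ffun L -> option R}) :=
  [forall x, forall y, (f x == Some y) ==> r x y] &&
  [forall x, forall x', forall y,
     (f x == Some y) ==> (f x' == Some y) ==> (x == x')].
have mP f : reflect (matching f) (mb f).
  apply: (iffP andP) => [[/forallP h1 /forallP h2]|[h1 h2]]; split.
  - by move=> x y /eqP fx; move/forallP/(_ y)/implyP: (h1 x); apply.
  - move=> x x' y /eqP fx /eqP fx'; apply/eqP.
    by move/forallP/(_ x')/forallP/(_ y): (h2 x); rewrite fx fx'.
  - by do 2!apply/forallP=> ?; apply/implyP => /eqP /h1.
  - do 3!apply/forallP=> ?; apply/implyP => /eqP e1; apply/implyP => /eqP e2.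
    by apply/eqP; apply: h2 e1 e2.
have m0 : mb [ffun=> None] by apply/mP; split=> [x y|x x' y]; rewrite ffunE.
have [f /mP mf fmax] := arg_maxnP msize m0; rewrite /= in fmax.
have [leq|ltq] := leqP q (msize f); first by left; exists f.
(* The cover consists of the unreached left vertices, all of them matched, and of the partners [D]
   of the reached ones; it thus injects into the matching. By maximality every neighbour of a
   reached vertex is matched, which makes it a cover. *)
right; pose Z := [set v : L | [exists u : L, (f u == None) && connect (alt f) u v]].
pose D := [set y : R | [exists v in Z, f v == Some y]].
have Zmatched x y : x \in Z -> r x y -> exists2 v, f v = Some y & v \in Z.
  rewrite [in X in X -> _]inE => /existsP[u /andP[/eqP fu /connectP[p0 pp0 ep0]]] rxy.
  have [v fv|nf] := pickP (fun v => f v == Some y).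
    exists v; first exact/eqP.
    rewrite inE; apply/existsP; exists u; rewrite fu eqxx.
    apply: (@connect_trans _ _ x); first by apply/connectP; exists p0.
    by apply/connect1/existsP; exists y; rewrite rxy.
  move: ep0; case/shortenP: pp0 => p pp up _ ep.
  have [||f' mf' sf'] := augment (y := y) mf fu pp up.
  - by rewrite -ep.
  - by move=> z /eqP; rewrite nf.
  by have := fmax f' (introT (mP f') mf'); rewrite sf' /= ltnn.
exists (~: Z), D; split; last first.
  move=> x y rxy; rewrite !inE; case: (boolP [exists _, _]) => //= xZ.
  have [|v fv vZ] := Zmatched x y _ rxy; first by rewrite inE.
  by apply/existsP; exists v; rewrite vZ fv eqxx.
apply: leq_ltn_trans ltq.
have nZ x : x \notin Z -> f x != None.
  apply: contra => fx; rewrite inE; apply/existsP; exists x.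
  by rewrite fx connect0.
have -> : msize f = #|~: Z| + #|[set x in Z | f x != None]|.
  rewrite /msize -(cardsID Z) addnC; congr (_ + _); apply: eq_card => x.
    rewrite in_setD in_setC [in X in _ && X]inE.
    by case: (boolP (x \in Z)) => //= /nZ ->.
  by rewrite in_setI [x \in [set _ | _]]inE [RHS]inE andbC.
rewrite leq_add2l.
suff sub : [set Some y | y in D] \subset [set f x | x in [set x in Z | f x != None]].
  rewrite -(card_imset _ (@Some_inj _)).
  exact: leq_trans (subset_leq_card sub) (leq_imset_card _ _).
apply/subsetP => _ /imsetP[y yD ->]; move: yD; rewrite inE.
move=> /existsP[v /andP[vZ /eqP fv]]; apply/imsetP; exists v => //.
by rewrite inE vZ fv.
Qed.
End Koenig.

(** * Menger's theorem for layered graphs, and subgraphs of bounded degree *)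

Section LayeredMenger.
Variables (T : finType) (r : rel T) (lay : T -> nat) (k : nat).

(* Koenig's theorem is applied to two copies of [T]: matching the two copies of
   [u] to each other means that no path uses [u], and matching the first copy
   of [u] to the second copy of [w] means that some path steps from [u] to [w]. *)
Let split_rel (u w : T) : bool :=
  [&& lay u <= k, 0 < lay w <= k.+1 &
      (u == w) || r u w && (lay w == (lay u).+1)].

Lemma layered_menger q :
  (exists P : 'I_q -> nat -> T,
     [/\ forall i j, j <= k.+1 -> lay (P i j) = j,
         forall i j, j <= k -> r (P i j) (P i j.+1) &
         forall i i' j, j <= k.+1 -> P i j = P i' j -> i = i']) \/
  (exists S Z : {set T},
     [/\ #|S| < q, forall v, lay v = 0 -> v \in Z :|: S,
         forall v, v \in Z -> lay v <= k &
         forall u w, u \in Z -> r u w -> lay w = (lay u).+1 -> w \in Z :|: S]).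
Proof.
pose Mid := [set v | 0 < lay v <= k].
(* The identity on the middle layers is a matching of size [#|Mid|] that stands for no path at all;
   each further unit is worth one path. *)
have [[f [fr finj] lef]|[C [D [ltCD cov]]]] := koenig split_rel (#|Mid| + q).
  left.
  pose X := fix X j := if j is j'.+1 then
      [set w | [exists u in X j', f u == Some w]] else [set v | lay v == 0].
  have step u w : f u = Some w -> f u <> Some u -> 
      [/\ r u w, lay w = (lay u).+1 & f w <> Some w].
    move=> fu nu; have /and3P[_ _ /orP[/eqP ew|/andP[ruw /eqP lw]]] := fr _ _ fu.
      by rewrite -ew in fu.
    by split=> // fw; apply: nu; rewrite -{2}(finj _ _ _ fw fu).
  have XP j w : w \in X j -> lay w = j /\ f w <> Some w.
    elim: j w => [|j IH] w /=; rewrite inE.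
      by move=> /eqP l0; split=> // /fr /and3P[_]; rewrite l0.
    by move=> /existsP[u /andP[/IH[<- nu] /eqP fu]]; have [] := step u w fu nu.
  have chain j w : w \in X j -> exists p : nat -> T, p j = w /\
      forall i, i < j -> p i \in X i /\ f (p i) = Some (p i.+1).
    elim: j w => [|j IH] w; first by exists (fun=> w).
    rewrite inE => /existsP[u /andP[/[dup] uX /IH [p [pj pP]] /eqP fu]].
    exists (fun i => if i <= j then p i else w); rewrite ltnn; split=> // i.
    rewrite ltnS => lij; rewrite lij; case: ltngtP lij => // [lij|->] _.
      exact: pP.
    by rewrite pj.
  (* Following [f] is injective, so walks from layer 0 are lost only at unmatched vertices. Counting
     all vertices up to layer [k] then leaves at least [q] of them in [X k.+1]. *)
  have cardX j : j <= k.+1 -> #|X 0| <= #|X j| + #|[set v | lay v < j & f v == None]|.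
    elim: j => [|j IH] lej; first exact: leq_addr.
    apply: leq_trans (IH (ltnW lej)) _.
    have -> : #|X j| = #|[set u in X j | f u != None]| + #|[set u in X j | f u == None]|.
      rewrite -(cardsID [set u | f u != None]); congr (_ + _); apply: eq_card => u.
        by rewrite !inE.
      by rewrite !inE negbK andbC.
    rewrite -addnA leq_add //.
      have fin : {in [set u in X j | f u != None] &, injective f}.
        move=> u u'; rewrite !inE => /andP[_ fu] _ e.
        by case E: (f u) fu => [y|] // _; apply: (finj _ _ y) => //; rewrite -e.
      rewrite -(card_in_imset fin) -[leqRHS](card_imset _ (@Some_inj _)).
      apply/subset_leq_card/subsetP=> o.
      move=> /imsetP[u]; rewrite inE => /andP[uX fu] ->.
      case E: (f u) fu => [y|] // _; apply/imsetP; exists y => //.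
      by rewrite inE; apply/existsP; exists u; rewrite uX E eqxx.
    rewrite -cardsUI; set I := _ :&: _.
    have -> : I = set0.
      apply/setP=> u; rewrite !inE; apply/negP => /andP[/andP[uX _] /andP[l _]].
      by have [lu _] := XP j u uX; rewrite lu ltnn in l.
    rewrite cards0 addn0; apply/subset_leq_card/subsetP=> u; rewrite !inE.
    case/orP => /andP[+ ->]; rewrite andbT; last exact: ltnW.
    by move=> /XP[-> _].
  have leqX : q <= #|X k.+1|.
    have := cardX k.+1 (leqnn _).
    have e1 : #|X 0| + #|Mid| = #|[set v | lay v <= k]|.
      rewrite -cardsUI; set I := _ :&: _.
      have -> : I = set0 by apply/setP=> u; rewrite !inE; lia.
      by rewrite cards0 addn0; apply: eq_card => u; rewrite !inE; lia.
    have e2 : #|[set v | lay v <= k]| = msize f + #|[set v | lay v < k.+1 & f v == None]|.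
      rewrite -cardsUI; set I := _ :&: _.
      have -> : I = set0 by apply/setP=> u; rewrite !inE; case: (f u) => [?|]; rewrite ?andbF.
      rewrite cards0 addn0; apply: eq_card => u; rewrite !inE ltnS.
      case E: (f u) => [y|] /=; last by rewrite andbT.
      by have /and3P[-> _ _] := fr _ _ E.
    by lia.
  pose x (i : 'I_q) := enum_val (widen_ord leqX i).
  have [P PP] : exists P : 'I_q -> nat -> T, forall i, P i k.+1 = x i /\
      forall j, j < k.+1 -> P i j \in X j /\ f (P i j) = Some (P i j.+1).
    have /fin_all_exists[P PP] (i : 'I_q) := chain k.+1 (x i) (enum_valP _).
    by exists P.
  have PX i j : j <= k.+1 -> P i j \in X j.
    rewrite leq_eqVlt => /orP[/eqP -> | lj]; last by have [_ /(_ j lj)[]] := PP i.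
    by have [-> _] := PP i; exact: enum_valP (widen_ord leqX i).
  exists P; split=> [i j /(PX i) /XP[] //|i j lj|i i' j].
    by have [_ /(_ j lj)[/XP[_ nu] /step /(_ nu)[]]] := PP i.
  (* Two paths that meet continue along [f] to the same vertex of the last layer, where [x] is
     injective. *)
  move=> lj; rewrite -(subKn lj); move: (k.+1 - j) (leq_subr j k.+1) => e.
  elim: e => [|e IH] le eP.
    move: eP; rewrite subn0; have [-> _] := PP i; have [-> _] := PP i'.
    by move/enum_val_inj/(congr1 val) => /= ?; apply: val_inj.
  apply: IH; first exact: ltnW.
  have le' : k.+1 - e.+1 < k.+1 by lia.
  have [_ /(_ _ le')[_ h1]] := PP i; have [_ /(_ _ le')[_ h2]] := PP i'.
  have ee : k.+1 - e = (k.+1 - e.+1).+1 by lia.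
  by rewrite ee; apply: Some_inj; rewrite -h1 -h2 eP.
right.
(* Because of the pairs [u == u], the cover contains a copy of each middle vertex; the vertices with
   both copies in it are the excess over [#|Mid|] and separate the middle layers. *)
pose S := [set v | [|| (lay v == 0) && (v \in C), (lay v == k.+1) && (v \in D)
  | [&& 0 < lay v <= k, v \in C & v \in D]]].
pose Z := [set v | (lay v <= k) && (v \notin C)].
exists S, Z; split.
- have : #|S| + #|Mid| <= #|C| + #|D|.
    pose S0 := [set v | (lay v == 0) && (v \in C)].
    pose S1 := [set v | (lay v == k.+1) && (v \in D)].
    pose CM := C :&: Mid; pose DM := D :&: Mid.
    have e0 : #|S| <= #|S0| + (#|S1| + #|CM :&: DM|).
      apply: leq_trans (leq_trans (leq_card_setU S0 (S1 :|: (CM :&: DM))) _).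
        by apply/subset_leq_card/subsetP=> v; rewrite !inE; lia.
      by rewrite leq_add2l leq_card_setU.
    have eM : #|Mid| <= #|CM :|: DM|.
      apply/subset_leq_card/subsetP=> v; rewrite !inE => lv.
      rewrite lv !andbT; apply: cov; rewrite /split_rel eqxx; lia.
    have eC : #|S0| + #|CM| <= #|C|.
      rewrite -(cardsID Mid C) addnC leq_add2l; apply/subset_leq_card/subsetP=> v.
      by rewrite !inE; lia.
    have eD : #|S1| + #|DM| <= #|D|.
      rewrite -(cardsID Mid D) addnC leq_add2l; apply/subset_leq_card/subsetP=> v.
      by rewrite !inE; lia.
    have := cardsUI CM DM; lia.
  by lia.
- by move=> v lv; rewrite !inE lv /=; case: (v \in C).
- by move=> v; rewrite inE => /andP[].
- move=> u w; rewrite inE => /andP[lu uC] ruw lw.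
  have : split_rel u w by rewrite /split_rel ruw lw eqxx orbT andbT; lia.
  move/cov; rewrite (negPf uC) /= => wD; rewrite !inE wD lw /=.
  by case: (w \in C) => /=; lia.
Qed.
End LayeredMenger.

(* The edges of [r] form the middle one of three layers; the outer layers hold
   [d] copies of each vertex. *)
Lemma degree_constrained (A B : finType) (r : A -> B -> bool) (d q : nat) :
  0 < d ->
  (exists F : {set A * B},
     [/\ q <= #|F|, forall x, x \in F -> r x.1 x.2,
         forall a, #|[set x in F | x.1 == a]| <= d &
         forall b, #|[set x in F | x.2 == b]| <= d]) \/
  (exists (C : {set A}) (D : {set B}),
     d * (#|C| + #|D|) +
       #|[set x : A * B | [&& r x.1 x.2, x.1 \notin C & x.2 \notin D]]| < q).
Proof.
move=> d_gt0; pose T : finType := ((A * 'I_d + B * 'I_d) + (A * B))%type.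
pose rT (u w : T) := match u, w with
  | inl (inl (a, _)), inr (a', b) => (a == a') && r a b
  | inr (a, b), inl (inr (b', _)) => b == b'
  | _, _ => false end.
pose lay (u : T) := match u with inl (inl _) => 0 | inr _ => 1 | _ => 2 end.
have [[P [Pl Pr Pinj]]|[S [Z [ltS Z0 Zl Zr]]]] := layered_menger rT lay 1 q.
  left.
  have PE i : exists a b j j', [/\ P i 0 = inl (inl (a, j)), P i 1 = inr (a, b),
      P i 2 = inl (inr (b, j')) & r a b].
    have := Pl i 0; have := Pl i 1; have := Pl i 2; have := Pr i 0; have := Pr i 1.
    case: (P i 0) => [[[a j]|[b j]]|[a b]] /=; try by move=> _ _ _ _ /(_ isT).
    case: (P i 1) => [[[a' j']|[b j']]|[a' b]] /=; try by move=> _ _ _ /(_ isT).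
    case: (P i 2) => [[[a'' j']|[b' j']]|[a'' b']] /=; try by move=> _ _ /(_ isT).
    move=> /(_ isT) /eqP <- /(_ isT) /andP[/eqP <- rab] _ _ _.
    by exists a, b, j, j'.
  have /fin_all_exists[a /fin_all_exists[b /fin_all_exists[j /fin_all_exists[j' PE']]]] := PE.
  pose f i := (a i, b i).
  have f_inj : injective f.
    move=> i i' [ea eb]; apply: (Pinj i i' 1) => //.
    by have [_ -> _ _] := PE' i; have [_ -> _ _] := PE' i'; rewrite ea eb.
  exists [set f i | i : 'I_q]; split.
  - by rewrite card_imset // card_ord.
  - by move=> _ /imsetP[i _ ->]; have [] := PE' i.
  - move=> a0; set G := finset _.
    have -> : G = [set f i | i in [set i | a i == a0]].
      apply/setP=> x; rewrite inE; apply/andP/imsetP => [[/imsetP[i _ ->] h]|[i h ->]].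
        by exists i; rewrite // inE.
      by rewrite inE in h; split=> //; apply/imsetP; exists i.
    rewrite card_imset // -[leqRHS]card_ord.
    have : {in [set i | a i == a0] &, injective j}.
      move=> i i'; rewrite !inE => /eqP e /eqP e' ej; apply: (Pinj i i' 0) => //.
      by have [-> _ _ _] := PE' i; have [-> _ _ _] := PE' i'; rewrite e e' ej.
    by move/card_in_imset <-; apply: max_card.
  - move=> b0; set G := finset _.
    have -> : G = [set f i | i in [set i | b i == b0]].
      apply/setP=> x; rewrite inE; apply/andP/imsetP => [[/imsetP[i _ ->] h]|[i h ->]].
        by exists i; rewrite // inE.
      by rewrite inE in h; split=> //; apply/imsetP; exists i.
    rewrite card_imset // -[leqRHS]card_ord.
    have : {in [set i | b i == b0] &, injective j'}.
      move=> i i'; rewrite !inE => /eqP e /eqP e' ej; apply: (Pinj i i' 2) => //.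
      by have [_ _ -> _] := PE' i; have [_ _ -> _] := PE' i'; rewrite e e' ej.
    by move/card_in_imset <-; apply: max_card.
right.
pose iA (x : A * 'I_d) : T := inl (inl x).
pose iB (x : B * 'I_d) : T := inl (inr x).
pose iE (x : A * B) : T := inr x.
(* An endpoint is charged only if all its [d] copies lie in [S]. Otherwise some copy is free, and an
   edge between two such endpoints must itself lie in [S]. *)
pose C := [set a | [forall j, iA (a, j) \in S]].
pose D := [set b | [forall j, iB (b, j) \in S]].
exists C, D; apply: leq_ltn_trans ltS.
set E := finset _.
have subE : iE @: E \subset S.
  apply/subsetP=> _ /imsetP[[a b] + ->]; rewrite !inE /= !negb_forall.
  move=> /and3P[rab /existsP[j aS] /existsP[j' bS]].
  have aZ : iA (a, j) \in Z by have := Z0 (iA (a, j)) erefl; rewrite inE (negPf aS) orbF.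
  have := Zr _ (iE (a, b)) aZ; rewrite /= eqxx rab => /(_ isT erefl).
  rewrite inE => /orP[eZ|//]; have := Zr _ (iB (b, j')) eZ.
  rewrite /= eqxx => /(_ isT erefl); rewrite inE (negPf bS) orbF => bZ.
  by have := Zl _ bZ.
have subC : iA @: setX C [set: 'I_d] \subset S.
  by apply/subsetP=> _ /imsetP[[a j] + ->]; rewrite !inE andbT /= => /forallP.
have subD : iB @: setX D [set: 'I_d] \subset S.
  by apply/subsetP=> _ /imsetP[[a j] + ->]; rewrite !inE andbT /= => /forallP.
have iA_inj : injective iA by move=> ? ? [].
have iB_inj : injective iB by move=> ? ? [].
have iE_inj : injective iE by move=> ? ? [].
have -> : d * (#|C| + #|D|) + #|E| =
  #|iA @: setX C [set: 'I_d]| + (#|iB @: setX D [set: 'I_d]| + #|iE @: E|).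
  by rewrite !card_imset // !cardsX !cardsT card_ord; lia.
rewrite -(cardsUI (iB @: _)) [X in _ + (_ + X)]eq_card0 => [|u]; last first.
  by rewrite inE; apply/negP => /andP[/imsetP[x _ ->] /imsetP[y _]].
rewrite addn0 -cardsUI [X in _ + X]eq_card0 => [|u]; last first.
  by rewrite !inE; apply/negP => /andP[/imsetP[x _ ->] /orP[]/imsetP[y _]].
by rewrite addn0; apply/subset_leq_card; rewrite !subUset subC subD subE.
Qed.

(** * Connecting vertices of a cut-dense graph *)

Section Words.
Variable V : finType.

Fixpoint words n : seq (seq V) :=
  if n is n'.+1 then [seq w :: s | w <- enum V, s <- words n'] else [:: [::]].

Lemma size_words n : size (words n) = #|V| ^ n.
Proof. by elim: n => //= n IH; rewrite size_allpairs IH -cardE expnS. Qed.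

Lemma mem_words n s : s \in words n -> size s = n.
Proof.
elim: n s => [|n IH] s /=; first by rewrite inE => /eqP ->.
by case/allpairsP=> -[w t] /= [_ /IH <- ->].
Qed.

Lemma count_words (P : pred (seq V)) n :
  count P (words n.+1) = \sum_w count (fun s => P (w :: s)) (words n).
Proof.
rewrite /= count_flatten -map_comp sumnE big_map big_enum /=.
by apply: eq_bigr => w _; rewrite count_map.
Qed.

(* [s] contains, as a subsequence read from its end, the interior of a walk
   from [x] to [z] *)
Fixpoint conn (e : rel V) x s z :=
  if s is w :: s' then conn e x s' z || (e w z && conn e x s' w)
  else (x == z) || e x z.

Lemma conn_path (e : rel V) x s z : conn e x s z ->
  exists p, [/\ path e x p, last x p = z & {subset p <= z :: s}].
Proof.
elim: s z => [|w s IH] z /=.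
  case/orP=> [/eqP ->|exz]; first by exists [::].
  by exists [:: z]; split; rewrite //= exz.
case/orP=> [/IH[p [pp lp sp]]|/andP[ewz /IH[p [pp lp sp]]]].
  by exists p; split=> // u /sp; rewrite !inE => /orP[]->; rewrite ?orbT.
exists (rcons p z); rewrite rcons_path last_rcons pp lp ewz; split=> // u.
by rewrite mem_rcons !inE => /orP[->|/sp]; rewrite // inE => /orP[]->; rewrite !orbT.
Qed.
End Words.

Section CutDense.
Variables (V : finType) (e : rel V) (g : nat) (X : {set V}).
Hypotheses (e_sym : symmetric e) (g_gt0 : 0 < g) (X4 : 4 <= #|X|).
Hypothesis bigX : #|V| <= g * #|X|.

Definition cut_dense := forall U : {set V}, U \subset X ->
  #|U| * #|X :\: U| <= g * \sum_(z in X :\: U) #|[set u in U | e z u]|.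

Hypothesis cutX : cut_dense.

(** A vertex with fewer than [#|V| / kappa] neighbours in a set of at least [#|V| / g ^ 2] vertices
    is adjacent to less than [1 / (2 g)] of it, half of the density that a cut guarantees. *)
Let kappa := 2 * g ^ 3.

Lemma cut_dense_deg x : x \in X -> #|X| <= (g * #|[set z in X :\ x | e x z]|).+1.
Proof.
move=> xX; have := cutX (U := [set x]); rewrite sub1set => /(_ xX).
rewrite cards1 mul1n => h; rewrite (cardsD1 x) xX add1n ltnS.
apply: leq_trans h _; rewrite leq_mul2l; apply/orP; right.
rewrite -sum1_card big_mkcond [leqRHS]big_mkcond; apply: leq_sum => z _.
rewrite !inE; case: (z \in X); rewrite ?andbF ?andbT //=; case: eqP => //= _.
case exz: (e x z) => /=; first by rewrite -(cards1 x) subset_leq_card //; apply/subsetP=> u; rewrite inE => /andP[].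
rewrite leqn0 cards_eq0; apply/eqP/setP=> u; rewrite !inE; case: eqP => //= ->.
by rewrite e_sym exz.
Qed.

(** [U j] collects vertices reached from [x] by a constant fraction of the words of length [j].
    While it misses more than [#|X| / (4 g)] vertices of [X], the cut between it and the rest adds
    at least [#|X| / (8 g ^ 2)] new ones, so this ends within [8 g ^ 2 + 1] steps. Then [y], of
    degree about [#|X| / g], has many neighbours in it, and one more letter reaches [y]. *)
Lemma conn_count x y : x \in X -> y \in X ->
  #|V| ^ (8 * g ^ 2).+2 <=
  kappa ^ (8 * g ^ 2).+2 * count (conn e x ^~ y) (words V (8 * g ^ 2).+2).
Proof.
move=> xX yX.
pose N (U : {set V}) z := #|[set u in U | e z u]|.
pose W' (U : {set V}) := [set z in X :\: U | #|V| <= kappa * N U z].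
pose U := fix U j := if j is j'.+1 then U j' :|: W' (U j')
                     else [set z in X | (x == z) || e x z].
have UX j : U j \subset X.
  elim: j => [|j IH] /=; first by apply/subsetP=> z; rewrite inE => /andP[].
  by rewrite subUset IH; apply/subsetP=> z; rewrite !inE => /andP[/andP[]].
have count_ge j z : z \in U j ->
    #|V| ^ j <= kappa ^ j * count (conn e x ^~ z) (words V j).
  elim: j z => [|j IH] z; first by rewrite inE => /andP[_] /= ->.
  have kappa_gt0 : 0 < kappa by rewrite muln_gt0 expn_gt0 g_gt0.
  rewrite count_words [U _]/= inE => /orP[zU|].
    apply: (@leq_trans (kappa ^ j * \sum_(w : V) count (conn e x ^~ z) (words V j))).
      by rewrite sum_nat_const mulnCA expnS leq_mul2l IH // orbT.
    apply: leq_mul; first by rewrite leq_pexp2l.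
    by apply: leq_sum => w _; apply: sub_count => s /= ->.
  rewrite inE => /andP[_ hz].
  apply: (@leq_trans (kappa * kappa ^ j * \sum_(w in [set u in U j | e z u])
      count (conn e x ^~ w) (words V j))); last first.
    rewrite -expnS leq_mul2l; apply/orP; right.
    rewrite big_mkcond /=; apply: leq_sum => w _; case: ifP => //.
    rewrite inE => /andP[_ ezw]; apply: sub_count => s /= ->.
    by rewrite e_sym ezw orbT.
  rewrite -mulnA big_distrr /=.
  apply: (@leq_trans (kappa * \sum_(w in [set u in U j | e z u]) #|V| ^ j)).
    by rewrite sum_nat_const mulnA expnS leq_mul2r hz orbT.
  rewrite leq_mul2l; apply/orP; right; apply: leq_sum => w.
  by rewrite inE => /andP[/IH].
have U0 : #|X| <= g * #|U 0|.
  have := cut_dense_deg xX.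
  have -> : #|U 0| = #|[set z in X :\ x | e x z]|.+1.
    rewrite [#|U 0|](cardsD1 x) !inE xX eqxx /= add1n; congr S.
    apply: eq_card => z; rewrite !inE eq_sym; case: eqP => //= _.
  nia.
have Umono j : #|U 0| <= #|U j|.
  by elim: j => // j IH; apply: leq_trans IH (subset_leq_card (subsetUl _ _)).
have VU j : #|V| <= g ^ 2 * #|U j|.
  apply: leq_trans bigX _; rewrite expnS expn1 -mulnA leq_mul2l.
  by rewrite (leq_trans U0) ?orbT // leq_mul2l Umono orbT.
have grow j : #|X :\: U j| <= 2 * g * #|W' (U j)|.
  have hc := cutX (UX j); have hV := VU j; have hm := Umono j.
  have hs : 2 * g * \sum_(z in X :\: U j) N (U j) z <=
      (2 * g * #|W' (U j)| + #|X :\: U j|) * #|U j|.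
    have -> : (2 * g * #|W' (U j)| + #|X :\: U j|) * #|U j| =
        \sum_(z in X :\: U j) (2 * g * (z \in W' (U j)) + 1) * #|U j|.
      rewrite -big_distrl big_split /= sum1_card; congr ((_ + _) * _).
      rewrite -big_distrr /= -sum1_card; congr (_ * _).
      rewrite [LHS]big_mkcond [RHS]big_mkcond /=.
      by apply: eq_bigr => z _; rewrite !inE; case: (z \in X); case: (z \in U j);
        case: (_ <= _); rewrite //= ?muln0 ?muln1.
    rewrite big_distrr /=; apply: leq_sum => z zW.
    have hN : N (U j) z <= #|U j|.
      by apply/subset_leq_card/subsetP=> u; rewrite inE => /andP[].
    rewrite [z \in W' _]inE zW /=; case: (leqP #|V|) => hk /=; first by nia.
    by have := leq_trans hk hV; rewrite /kappa !expnS !expn0; nia.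
  have Upos : 0 < #|U j| by apply: leq_trans hm; move: U0; case: #|U 0| => //; lia.
  have := leq_mul (leqnn 2) hc; rewrite !mulnA in hs * => h2.
  rewrite -(leq_pmul2r Upos); rewrite /N in hs; nia.
have prog j : 4 * g * #|X :\: U j| <= #|X| \/ j * #|X| <= 8 * g ^ 2 * #|U j|.
  elim: j => [|j IH]; first by right.
  have cU : #|U j.+1| = #|U j| + #|W' (U j)|.
    rewrite /= -cardsUI [X in _ = _ + X](_ : _ = 0) ?addn0 //.
    apply/eqP; rewrite cards_eq0; apply/eqP/setP=> z; rewrite !inE.
    by case: (z \in U j).
  have lW : #|X :\: U j.+1| <= #|X :\: U j|.
    by apply/subset_leq_card/setDS/subsetUl.
  have := grow j; case: IH; first by left; nia.
  case: (leqP (4 * g * #|X :\: U j|) #|X|) => [|lt]; first by left; nia.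
  by right; rewrite cU; nia.
have last : 4 * g * #|X :\: U (8 * g ^ 2).+1| <= #|X|.
  have [//|h] := prog (8 * g ^ 2).+1.
  have := leq_trans h (leq_mul (leqnn _) (subset_leq_card (UX _))).
  rewrite mulSn; lia.
move: (8 * g ^ 2).+1 last => J last.
apply: count_ge; rewrite [U _]/= inE.
case: (boolP (y \in U J)) => //= yU; rewrite !inE yU yX /=.
have dy := cut_dense_deg yX.
have sp : #|[set z in X :\ y | e y z]| <= N (U J) y + #|X :\: U J|.
  rewrite -(cardsID (U J)) leq_add //.
    by apply/subset_leq_card/subsetP=> z; rewrite !inE => /andP[/andP[_ ->] ->].
  by apply/subset_leq_card/subsetP=> z; rewrite !inE => /andP[-> /andP[/andP[_ ->]]].
move: last sp dy; set n := N _ _; set w := #|X :\: _|; set d := #|finset _| => last sp dy.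
have h1 : #|X| <= 2 * g * n by nia.
apply: leq_trans bigX _; rewrite /kappa.
have h2 : g * #|X| <= g * (2 * g * n) by rewrite leq_mul2l h1 orbT.
apply: leq_trans h2 _; rewrite !expnS expn0; nia.
Qed.
End CutDense.

(** Greedy: linking two consecutive tiles of [ts] uses up one word of [rs], so every pair of ends
    keeps at least one word per remaining tile. The last clause of the conclusion serves the
    induction: the path starts with its first tile, to whose head the preceding tile can be
    linked. *)
Lemma assemble (V : finType) (e : rel V) (x0 : V) (ts rs : seq (seq V)) :
  ts != [::] -> (forall t, t \in ts -> t != [::] /\ sorted e t) ->
  uniq (flatten ts) -> pairwise (fun s t : seq V => ~~ has [in s] t) rs ->
  ~~ has [in flatten ts] (flatten rs) ->
  (forall t t', t \in ts -> t' \in ts ->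
     size ts <= count (fun s => conn e (last x0 t) s (head x0 t')) rs) ->
  exists p, [/\ sorted e p, uniq p, size (flatten ts) <= size p,
    {subset p <= flatten ts ++ flatten rs} & exists q, p = head [::] ts ++ q].
Proof.
elim: ts rs => [//|t [|t' ts] IH] rs _ tsP uts prs dis hits.
  have [tn st] := tsP t (mem_head _ _); exists t.
  rewrite /= cats0 in uts *; split=> //; last by exists [::]; rewrite cats0.
  by move=> v vt; rewrite mem_cat vt.
have [|s srs sP] := hasP (_ : has (fun s => conn e (last x0 t) s (head x0 t')) rs).
  rewrite has_count; apply: leq_trans (hits t t' _ _) => //; rewrite !inE eqxx ?orbT //.
have [tn st] := tsP t (mem_head _ _).
have [tn' st'] : t' != [::] /\ sorted e t' by apply: tsP; rewrite !inE eqxx orbT.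
case/splitPr: srs prs dis hits => r1 r2 prs dis hits.
have mono : {subset flatten (r1 ++ r2) <= flatten (r1 ++ s :: r2)}.
  by move=> v; rewrite !flatten_cat /= !mem_cat => /orP[]->; rewrite ?orbT.
move: uts; rewrite [flatten _]/= cat_uniq => /and3P[ut dt uts].
have [||||q [sq uq szq subq [q0 eq0]]] := IH (r1 ++ r2) isT _ uts.
- by move=> u uts'; apply: tsP; rewrite inE uts' orbT.
- move: prs; rewrite !pairwise_cat allrel_consr /=.
  by case/and3P=> /andP[_ ->] -> /andP[_ ->].
- apply: contra dis => /hasP[v vr vt]; apply/hasP; exists v.
    exact: mono.
  by rewrite /= mem_cat vt orbT.
- move=> u u' uts' uts''; have := hits u u'.
  rewrite inE uts' orbT inE uts'' orbT => /(_ isT isT).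
  rewrite !count_cat /= addnCA => hit.
  by rewrite -ltnS (leq_trans hit) // -add1n leq_add2r leq_b1.
set h := head x0 t' in sP.
have [q1 eq1] : exists q1, q = h :: q1.
  by move: eq0; rewrite /h /=; case: (t') tn' => [//|a b] _ /= ->; eexists.
have ht' : h \in flatten (t' :: ts).
  by rewrite /h /= mem_cat; case: (t') tn' => //= a b _; rewrite mem_head.
have lt : last x0 t \in t by case: (t) tn => //= a b _; apply: mem_last.
have [pp0 [ppath plast psub]] := conn_path sP.
(* A word only gives a walk; it is shortened to a path before use. *)
move: plast; case/shortenP: ppath => pp ppath pun pps plast.
have {psub} psub v : v \in pp -> v = h \/ v \in s.
  by move=> /pps/psub; rewrite inE => /predU1P.
have dts v : v \in flatten (t :: t' :: ts) -> v \notin flatten (r1 ++ s :: r2).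
  by move=> vt; apply: contra dis => vr; apply/hasP; exists v.
have sin v : v \in s -> v \in flatten (r1 ++ s :: r2).
  by move=> vs; rewrite flatten_cat mem_cat /= mem_cat vs orbT.
have sr v : v \in s -> v \notin flatten (r1 ++ r2).
  move=> vs; apply/flattenP=> -[r' + vr']; rewrite mem_cat => rr.
  move: prs; rewrite pairwise_cat allrel_consr /= => /and3P[/andP[/allP p1 _] _ /andP[/allP p2 _]].
  case/orP: rr => [/p1|/p2] /negP; apply; apply/hasP; by exists v.
have qt v : v \in q -> v \notin t.
  move=> /subq; rewrite mem_cat => /orP[vq|vr].
    by apply: contra dt => vt; apply/hasP; exists v.
  apply: contraL vr => vt; have := dts v; rewrite [flatten _]/= mem_cat vt => /(_ isT).
  by apply: contra => /mono.
have ppn : 0 < size pp.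
  case: (pp) plast => //= e0; have := qt h; rewrite eq1 mem_head => /(_ isT).
  by rewrite -e0 lt.
exists (t ++ pp ++ q1); split.
- have -> : sorted e (t ++ pp ++ q1) = sorted e t && path e (last x0 t) (pp ++ q1).
    by case: (t) tn => //= a b _; rewrite cat_path.
  by rewrite st cat_path ppath plast /=; move: sq; rewrite eq1.
- move: uq; rewrite eq1 /= => /andP[hq1 uq1].
  rewrite !cat_uniq ut uq1 has_cat negb_or /= andbT.
  move: pun => /= /andP[_ ->] /=.
  rewrite -andbA; apply/and3P; split.
  + apply/hasPn => v /psub[->|vs]; first by apply: qt; rewrite eq1 mem_head.
    by apply: contraL (sin v vs) => vt; apply: dts; rewrite /= mem_cat vt.
  + by apply/hasPn => v vq; apply: qt; rewrite eq1 inE vq orbT.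
  + apply/hasPn => v vq1; apply/negP => /psub[ev|vs]; first by rewrite -ev vq1 in hq1.
    have : v \in q by rewrite eq1 inE vq1 orbT.
    move/subq; rewrite mem_cat (negPf (sr v vs)) orbF => vt.
    by have := dts v; rewrite [flatten _]/= mem_cat vt orbT sin // => /(_ isT).
- change (size (t ++ flatten (t' :: ts)) <= size (t ++ pp ++ q1)).
  rewrite !(size_cat t) leq_add2l (size_cat pp); apply: leq_trans szq _.
  by rewrite eq1 /= -add1n leq_add2r.
- have fl u : (u \in t) || (u \in flatten (t' :: ts)) ->
      u \in flatten [:: t, t' & ts] ++ flatten (r1 ++ s :: r2).
    by move=> h'; rewrite mem_cat; apply/orP; left; rewrite /= mem_cat.
  have fr u : u \in flatten (r1 ++ s :: r2) ->
      u \in flatten [:: t, t' & ts] ++ flatten (r1 ++ s :: r2).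
    by move=> h'; rewrite mem_cat h' orbT.
  move=> v; rewrite (mem_cat v t) (mem_cat v pp) => /or3P[vt|/psub[->|vs]|vq].
  + by apply: fl; rewrite vt.
  + by apply: fl; rewrite ht' orbT.
  + by apply: fr; apply: sin.
  + have : v \in q by rewrite eq1 inE vq orbT.
    move/subq; rewrite mem_cat => /orP[vf|/mono]; last exact: fr.
    by apply: fl; rewrite vf orbT.
- by eexists.
Qed.

(** * Three colours with small covers: the exact statement *)

Section Colours.
Variables (A B K : finType).

(* [labA] and [labB] name the component of a vertex in one colour, and [covA] and
   [covB] form a vertex cover of that colour class, so an edge of this colour is a
   [joined] pair. *)
Record colour := Colour
  { labA : A -> K; labB : B -> K; covA : {set A}; covB : {set B} }.

Definition joined (c : colour) x y : bool :=
  (labA c x == labB c y) && ((x \in covA c) || (y \in covB c)).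
Definition clsA c k : {set A} := [set x | labA c x == k].
Definition clsB c k : {set B} := [set y | labB c y == k].
Definition strA c k : {set A} := [set x in covA c | labA c x == k].
Definition strB c k : {set B} := [set y in covB c | labB c y == k].

Record covered_by s r b g : Prop := CoveredBy {
  sizeA : #|A| = (3 * s).+1;
  sizeB : #|B| = (3 * s).+1;
  loads : forall c, [\/ c = r, c = b | c = g] -> forall k, #|strA c k| + #|strB c k| <= s;
  all_joined : forall x y, [|| joined r x y, joined b x y | joined g x y] }.
End Colours.

Definition swapc A B K (c : colour A B K) : colour B A K :=
  Colour (labB c) (labA c) (covB c) (covA c).

Lemma joined_swap A B K (c : colour A B K) x y : joined (swapc c) y x = joined c x y.
Proof. by rewrite /joined /= eq_sym orbC. Qed.

Section Symmetry.
Variables (A B K : finType) (s : nat) (r b g : colour A B K).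
Hypothesis H : covered_by s r b g.

Lemma covered_swap : covered_by s (swapc r) (swapc b) (swapc g).
Proof.
split; [exact: sizeB H|exact: sizeA H| |].
  by move=> c [->|->|->] k; rewrite addnC; apply: (loads H); [apply: Or31|apply: Or32|apply: Or33].
by move=> x y; rewrite !joined_swap (all_joined H).
Qed.

Lemma covered_rbg : covered_by s r g b.
Proof.
split; [exact: sizeA H|exact: sizeB H| |].
  by move=> c [->|->|->] k; apply: (loads H); [apply: Or31|apply: Or33|apply: Or32].
by move=> x y; have := all_joined H x y; case: (joined r x y); case: (joined b x y); case: (joined g x y).
Qed.

Lemma covered_brg : covered_by s b r g.
Proof.
split; [exact: sizeA H|exact: sizeB H| |].
  by move=> c [->|->|->] k; apply: (loads H); [apply: Or32|apply: Or31|apply: Or33].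
by move=> x y; have := all_joined H x y; case: (joined r x y); case: (joined b x y); case: (joined g x y).
Qed.

Lemma loadr k : #|strA r k| + #|strB r k| <= s. Proof. by apply: (loads H); apply: Or31. Qed.
Lemma loadb k : #|strA b k| + #|strB b k| <= s. Proof. by apply: (loads H); apply: Or32. Qed.
Lemma loadg k : #|strA g k| + #|strB g k| <= s. Proof. by apply: (loads H); apply: Or33. Qed.

Lemma leq_card_setU3 (T : finType) (X Y Z : {set T}) :
  #|X :|: Y :|: Z| <= #|X| + #|Y| + #|Z|.
Proof. by apply: leq_trans (leq_card_setU _ _) _; rewrite leq_add2r leq_card_setU. Qed.

(* Otherwise each colour joins [x] to at most [s] vertices, either because [x] is
   not in the cover or because its class is small. *)
Lemma strong_big x :
  [\/ x \in covA r /\ s < #|clsB r (labA r x)|,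
      x \in covA b /\ s < #|clsB b (labA b x)| |
      x \in covA g /\ s < #|clsB g (labA g x)|].
Proof.
have h (c : colour A B K) : (forall k, #|strA c k| + #|strB c k| <= s) ->
   x \in covA c /\ s < #|clsB c (labA c x)| \/ #|[set y | joined c x y]| <= s.
  move=> load; case: (boolP (x \in covA c)) => xc; last first.
    right; apply: leq_trans (leq_trans (leq_addl _ _) (load (labA c x))).
    apply/subset_leq_card/subsetP=> y; rewrite !inE /joined (negPf xc) /= andbC.
    by rewrite [labB _ _ == _]eq_sym.
  case: (leqP #|clsB c (labA c x)| s) => hs; [right|by left].
  apply: leq_trans hs; apply/subset_leq_card/subsetP=> y; rewrite !inE /joined.
  by rewrite eq_sym => /andP[].
have [?|hr] := h r loadr; first exact: Or31.
have [?|hb] := h b loadb; first exact: Or32.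
have [?|hg] := h g loadg; first exact: Or33.
exfalso; have : #|B| <= #|[set y | joined r x y]| + #|[set y | joined b x y]| + #|[set y | joined g x y]|.
  apply: leq_trans (leq_card_setU3 _ _ _); rewrite -cardsT.
  by apply/subset_leq_card/subsetP=> y _; rewrite !inE -orbA (all_joined H).
by rewrite (sizeB H); lia.
Qed.

(** An edge of colour [b] or [g] at such an [x] must be covered at its other end, so every other
    vertex is left to [r]. *)
Lemma weak_two x : x \notin covA b -> x \notin covA g -> x \in covA r /\
  forall y, y \notin strB b (labA b x) -> y \notin strB g (labA g x) -> labB r y = labA r x.
Proof.
move=> xb xg; split; first by case: (strong_big x) => -[]; rewrite ?(negPf xb) ?(negPf xg).
move=> y; rewrite !inE => yb yg; have := all_joined H x y.
rewrite /joined (negPf xb) (negPf xg) /=.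
case/or3P=> [/andP[/eqP -> //]|/andP[/eqP e yc]|/andP[/eqP e yc]].
  by rewrite yc -e eqxx in yb.
by rewrite yc -e eqxx in yg.
Qed.

Lemma not_three_bigA (k1 k2 k3 : K) : k1 != k2 -> k1 != k3 -> k2 != k3 ->
  s < #|clsA r k1| -> s < #|clsA r k2| -> s < #|clsA r k3| -> False.
Proof.
move=> neq12 n13 n23 h1 h2 h3.
have : #|clsA r k1| + #|clsA r k2| + #|clsA r k3| <= #|A|.
  rewrite -cardsUI [X in _ + X + _]eq_card0 ?addn0 => [|x]; last first.
    by rewrite !inE; case: eqP => // ->; rewrite (negPf neq12).
  rewrite -cardsUI [X in _ + X]eq_card0 ?addn0 ?max_card // => x.
  rewrite !inE; case: (labA r x =P k3) => [->|]; rewrite ?andbF // andbT.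
  by rewrite eq_sym (negPf n13) eq_sym (negPf n23).
by rewrite (sizeA H); lia.
Qed.
End Symmetry.

Lemma not_three_bigB (A B K : finType) s (r b g : colour A B K) (H : covered_by s r b g)
   (k1 k2 k3 : K) : k1 != k2 -> k1 != k3 -> k2 != k3 ->
  s < #|clsB r k1| -> s < #|clsB r k2| -> s < #|clsB r k3| -> False.
Proof. exact: (not_three_bigA (covered_swap H)). Qed.

Lemma two_big (A B K : finType) s (r b g : colour A B K) (H : covered_by s r b g) :
  exists k1 k2, forall k, s < #|clsA r k| -> k = k1 \/ k = k2.
Proof.
have [x0 _] : exists x0 : A, x0 \in A.
  by apply/card_gt0P; rewrite (sizeA H).
have [k1 h1|none] := pickP (fun k => s < #|clsA r k|); last first.
  by exists (labA r x0), (labA r x0) => k; rewrite none.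
have [k2 /andP[neq12 h2]|none] := pickP (fun k => (k1 != k) && (s < #|clsA r k|)).
  exists k1, k2 => k hk; have [->|nk1] := eqVneq k k1; first by left.
  have [->|nk2] := eqVneq k k2; first by right.
  by case: (not_three_bigA H neq12 _ _ h1 h2 hk); rewrite eq_sym.
exists k1, k1 => k hk; left; apply/eqP; rewrite eq_sym.
by have := none k; rewrite hk andbT => /negbFE.
Qed.

(* A class is big on a side if it holds more than [s] vertices of it. Between the
   [R1] and [R2] parts of [A] and the [R3] part of [B] the colour [r] is absent, so
   these large sets span a complete bipartite graph in only two colours. *)
Record config (A B K : finType) s (r : colour A B K) (R1 R2 R3 : K) : Prop := Config {
  neq12 : R1 != R2; neq31 : R3 != R1; neq32 : R3 != R2;
  bigA1 : s < #|clsA r R1|; bigA2 : s < #|clsA r R2|; bigB3 : s < #|clsB r R3| }.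

(** * Structure of a configuration: two colours on a complete bipartite block *)

Section Config.
Variables (A B K : finType) (s : nat) (r b g : colour A B K).
Hypothesis H : covered_by s r b g.
Variables (R1 R2 R3 : K).
Hypothesis C : config s r R1 R2 R3.
Let W := clsA r R1 :|: clsA r R2.
Let U := clsB r R3.

Lemma W_red x : x \in W -> labA r x = R1 \/ labA r x = R2.
Proof. by rewrite !inE => /orP[]/eqP; [left|right]. Qed.

Lemma sizeW : 2 * s + 2 <= #|W|.
Proof.
rewrite -[#|W|]addn0 -[0 in leqRHS](_ : #|clsA r R1 :&: clsA r R2| = 0); last first.
  by apply: eq_card0 => x; rewrite !inE; case: eqP => // ->; rewrite (negPf (neq12 C)).
by rewrite cardsUI; have := bigA1 C; have := bigA2 C; lia.
Qed.

Lemma size_offW : #|~: W| < s.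
Proof. by have := cardsC W; have := sizeW; rewrite (sizeA H); lia. Qed.

Lemma bigA_meetsW (c : colour A B K) k : s < #|clsA c k| -> exists2 x : A, x \in W & labA c x = k.
Proof.
move=> hk; have [x|none] := pickP [pred x in W | labA c x == k].
  by move=> /andP[xW /eqP]; exists x.
have : #|clsA c k| <= #|~: W|.
  apply/subset_leq_card/subsetP=> x; rewrite !inE => xk.
  by have := none x; rewrite /= xk andbT !inE => ->.
by have := size_offW; lia.
Qed.

Lemma bigA_red k : s < #|clsA r k| -> k = R1 \/ k = R2.
Proof. by case/bigA_meetsW => x /W_red[] -> <-; [left|right]. Qed.

(** If [b] has one label on [W], then at most five classes are big on [A], and by [strong_big] their
    strong parts contain [B]. Their loads leave at most [2 s - 1] strong vertices on the other side,
    so some [x] in [W] is strong in none of them. Then [x] is weak in [r] and [b], and its [g] class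
    is not big; [weak_two] now puts all of [B] into three strong parts, of total size at most
    [3 s]. *)
Lemma W_not_constant k : ~ (forall x, x \in W -> labA b x = k).
Proof.
move=> Wk; have [g1 [g2 hg]] := two_big (covered_brg (covered_rbg H)).
pose PA := strA r R1 :|: strA r R2 :|: strA b k :|: (strA g g1 :|: strA g g2).
pose PB := strB r R1 :|: strB r R2 :|: strB b k :|: (strB g g1 :|: strB g g2).
have cardU (T : finType) (X Y Z X' Y' : {set T}) :
    #|X :|: Y :|: Z :|: (X' :|: Y')| <= #|X| + #|Y| + #|Z| + (#|X'| + #|Y'|).
  by apply: leq_trans (leq_card_setU _ _) _; rewrite leq_add ?leq_card_setU3 ?leq_card_setU.
have bigb k' : s < #|clsA b k'| -> k' = k.
  by case/bigA_meetsW => x /Wk -> <-.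
have BPB : #|B| <= #|PB|.
  rewrite -cardsT; apply/subset_leq_card/subsetP=> y _.
  have [[/= yc]|[/= yc]|[/= yc]] := strong_big (covered_swap H) y.
  - by case/bigA_red => ey; rewrite !inE yc ey eqxx ?orbT.
  - by move/bigb => ey; rewrite !inE yc ey eqxx ?orbT.
  - by case/hg => ey; rewrite !inE yc ey eqxx ?orbT.
have hPB : #|PB| <= _ := cardU _ (strB r R1) (strB r R2) (strB b k) (strB g g1) (strB g g2).
have hPA : #|PA| <= _ := cardU _ (strA r R1) (strA r R2) (strA b k) (strA g g1) (strA g g2).
have := loadr H R1; have := loadr H R2; have := loadb H k.
have := loadg H g1; have := loadg H g2 => l1 l2 l3 l4 l5.
have PAW : #|PA| < #|W| by have := sizeW; rewrite (sizeB H) in BPB; lia.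
have [x xW xPA] : exists2 x, x \in W & x \notin PA.
  by apply/subsetPn; apply: contraTN PAW => /subset_leq_card; rewrite -leqNgt.
have xk := Wk x xW.
have [xr xb] : x \notin covA r /\ x \notin covA b.
  move: xPA; rewrite !inE xk eqxx andbT; case: (W_red xW) => ->; rewrite eqxx;
  by case: (x \in covA r); case: (x \in covA b); rewrite ?orbT.
have [xg hx] := weak_two (covered_brg (covered_rbg H)) xr xb.
have xgn : ~~ (s < #|clsA g (labA g x)|).
  by apply: contra xPA => /hg[] e; rewrite !inE xg e eqxx ?orbT.
have : #|B| <= #|strB r R1| + #|strB r R2| + #|strB b k|.
  apply: leq_trans (leq_card_setU3 _ _ _); rewrite -cardsT.
  apply/subset_leq_card/subsetP=> y _.
  case: (boolP (y \in strB r (labA r x))) => y1.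
    by case: (W_red xW) y1 => -> y1; rewrite in_setU in_setU y1 ?orbT.
  case: (boolP (y \in strB b (labA b x))) => y2.
    by rewrite in_setU -xk y2 orbT.
  have yg := hx y y1 y2.
  have [[/= yc]|[/= yc]|[/= yc]] := strong_big (covered_swap H) y.
  - by case/bigA_red => ey; rewrite !inE yc ey eqxx ?orbT.
  - by move/bigb => ey; rewrite !inE yc ey eqxx ?orbT.
  - by rewrite yg => h; rewrite h in xgn.
rewrite (sizeB H); lia.
Qed.

(** Every vertex of [U] would be strong in the class [b1] or [g1], since [R3] is not big on [A].
    These two loads then leave more than [s] vertices [W0] of [W] weak in both. Each of them must
    share both labels with [U], so [r] joins it to a fixed [z] outside both strong parts, and [W0]
    overloads the [r] class of [z]. *)
Lemma U_not_constant b1 g1 :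
  ~ (forall y, y \in U -> labB b y = b1 /\ labB g y = g1).
Proof.
move=> Utype.
have Ustrong y : y \in U -> y \in strB b b1 :|: strB g g1.
  move=> yU; have [eb eg] := Utype y yU.
  have [[/= yc]|[/= yc]|[/= yc]] := strong_big (covered_swap H) y.
  - move: yU; rewrite inE => /eqP ->; case/bigA_red => e; move: (neq31 C) (neq32 C);
    by rewrite e eqxx.
  - by move=> _; rewrite !inE yc eb eqxx.
  - by move=> _; rewrite !inE yc eg eqxx orbT.
have lb := loadb H b1; have lg := loadg H g1.
have cU : #|U| <= #|strB b b1| + #|strB g g1|.
  apply: leq_trans (leq_card_setU _ _); apply/subset_leq_card/subsetP; exact: Ustrong.
have U3 : s < #|U| := bigB3 C.
pose W0 := W :\: (strA b b1 :|: strA g g1).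
have cW0 : s < #|W0|.
  have e : #|W :&: (strA b b1 :|: strA g g1)| + #|W0| = #|W| := cardsID _ _.
  have : #|W :&: (strA b b1 :|: strA g g1)| <= #|strA b b1| + #|strA g g1|.
    by apply: leq_trans (leq_card_setU _ _); apply/subset_leq_card/subsetIr.
  by have : 2 * s + 2 <= #|W| := sizeW; lia.
have [y yU yb] : exists2 y, y \in U & y \notin strB b b1.
  by apply/subsetPn; apply/negP => /subset_leq_card; lia.
have [y' yU' yg] : exists2 y, y \in U & y \notin strB g g1.
  by apply/subsetPn; apply/negP => /subset_leq_card; lia.
have [z zbg] : exists z, z \notin strB b b1 :|: strB g g1.
  suff /subsetPn[z] : ~~ ([set: B] \subset strB b b1 :|: strB g g1) by exists z.
  apply/negP => /subset_leq_card; rewrite cardsT (sizeB H).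
  by have := leq_of_leqif (leq_card_setU (strB b b1) (strB g g1)); lia.
have nred x u : x \in W -> u \in U -> labA r x == labB r u = false.
  rewrite [u \in _]inE => /W_red[] -> /eqP ->; apply/negbTE; rewrite eq_sym; [exact: (neq31 C)|exact: (neq32 C)].
have W0P w : w \in W0 -> w \in strA r (labB r z).
  rewrite inE in_setU negb_or => /andP[/andP[xb xg] xW].
  have xg1 : labA g w = g1.
    have := all_joined H w y; rewrite /joined (nred w y) //=.
    have [-> ->] := Utype y yU; rewrite !inE in xb yb.
    case/orP=> /andP[/eqP e h]; last by [].
    by move: xb yb h; rewrite e eqxx; have [-> _] := Utype y yU; rewrite eqxx !andbT => /negPf -> /negPf ->.
  have xb1 : labA b w = b1.
    have := all_joined H w y'; rewrite /joined (nred w y') //=.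
    have [-> ->] := Utype y' yU'; rewrite !inE in xg yg.
    case/orP=> /andP[/eqP e h]; first by [].
    by move: xg yg h; rewrite e eqxx; have [_ ->] := Utype y' yU'; rewrite eqxx !andbT => /negPf -> /negPf ->.
  have xcb : w \notin covA b by move: xb; rewrite inE xb1 eqxx andbT.
  have xcg : w \notin covA g by move: xg; rewrite inE xg1 eqxx andbT.
  have [xr /(_ z)] := weak_two H xcb xcg; rewrite xb1 xg1.
  by move: zbg; rewrite in_setU negb_or => /andP[-> ->] /(_ isT isT) ->; rewrite inE xr eqxx.
have : #|W0| <= #|strA r (labB r z)| by apply/subset_leq_card/subsetP.
by have := loadr H (labB r z); lia.
Qed.
End Config.

(** The red-free block between [W] and [U] has a 2 by 2 pattern: each side has two types, all four
    occur, and two vertices from opposite sides agree in exactly one of the labels of [b] and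
    [g]. *)
Record crossed (A B K : finType) (r b g : colour A B K) (R1 R2 R3 b1 b2 g1 g2 : K) : Prop :=
  Crossed {
  neq_b : b1 != b2; neq_g : g1 != g2;
  crossW : forall x, x \in clsA r R1 :|: clsA r R2 ->
    labA b x = b1 /\ labA g x = g1 \/ labA b x = b2 /\ labA g x = g2;
  crossU : forall y, y \in clsB r R3 ->
    labB b y = b1 /\ labB g y = g2 \/ labB b y = b2 /\ labB g y = g1;
  W11 : exists2 x, x \in clsA r R1 :|: clsA r R2 & labA b x = b1;
  W22 : exists2 x, x \in clsA r R1 :|: clsA r R2 & labA b x = b2;
  U12 : exists2 y, y \in clsB r R3 & labB b y = b1;
  U21 : exists2 y, y \in clsB r R3 & labB b y = b2 }.

Section Crossed.
Variables (A B K : finType) (s : nat) (r b g : colour A B K).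
Hypothesis H : covered_by s r b g.

(** Vertices of [W] and [U] always agree in [b] or in [g]. Take [y0], [y1] of different types in
    [U]. If they had the same [b] label, a vertex of [W] with another [b] label would agree with
    both in [g], so their types would coincide; likewise with [b] and [g] exchanged. The four
    combinations of their labels determine all types. *)
Lemma config_crossed R1 R2 R3 : config s r R1 R2 R3 ->
  exists b1 b2 g1 g2, crossed r b g R1 R2 R3 b1 b2 g1 g2.
Proof.
move=> C.
set W := clsA r R1 :|: clsA r R2; set U := clsB r R3.
have agree x y : x \in W -> y \in U -> labA b x = labB b y \/ labA g x = labB g y.
  move=> xW; rewrite inE => /eqP yU; have := all_joined H x y.
  have nr : labA r x == labB r y = false.
    rewrite yU; apply/negbTE; rewrite eq_sym.
    by case: (W_red xW) => ->; [exact: (neq31 C)|exact: (neq32 C)].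
  by rewrite /joined nr => /= /orP[]/andP[/eqP ? _]; [left|right].
have [y0 y0U] : exists y, y \in U by apply/card_gt0P; apply: leq_trans (bigB3 C).
have [y1 /andP[y1U n01]|none] := pickP [pred y in U |
    ~~ ((labB b y == labB b y0) && (labB g y == labB g y0))]; last first.
  case: (U_not_constant H C (b1 := labB b y0) (g1 := labB g y0)) => y yU.
  by have := none y; rewrite /= yU => /negbFE /andP[/eqP -> /eqP ->].
have nconst c k : c = b \/ c = g -> exists2 x, x \in W & labA c x != k.
  move=> cbg; have [x /andP[xW xk]|none] := pickP [pred x in W | labA c x != k].
    by exists x.
  have Wk x : x \in W -> labA c x = k.
    by move=> xW; have := none x; rewrite /= xW => /negbFE/eqP.
  case: cbg Wk => -> Wk; first by case: (W_not_constant H C Wk).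
  by case: (W_not_constant (covered_rbg H) C Wk).
have nb01 : labB b y0 != labB b y1.
  apply/eqP => e; have [x xW] := nconst b (labB b y0) (or_introl erefl).
  case: (agree x y0 xW y0U) => [->|e0]; first by rewrite eqxx.
  case: (agree x y1 xW y1U) => [->|e1]; first by rewrite e eqxx.
  by move: n01; rewrite e eqxx -e1 e0 eqxx.
have ng01 : labB g y0 != labB g y1.
  apply/eqP => e; have [x xW] := nconst g (labB g y0) (or_intror erefl).
  case: (agree x y0 xW y0U) => [e0|->]; last by rewrite eqxx.
  case: (agree x y1 xW y1U) => [e1|->]; last by rewrite e eqxx.
  by move: nb01; rewrite -e0 e1 eqxx.
have WP x : x \in W -> labA b x = labB b y0 /\ labA g x = labB g y1 \/
    labA b x = labB b y1 /\ labA g x = labB g y0.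
  move=> xW; case: (agree x y0 xW y0U) => e0; case: (agree x y1 xW y1U) => e1.
  - by move: nb01; rewrite -e0 e1 eqxx.
  - by left.
  - by right.
  - by move: ng01; rewrite -e0 e1 eqxx.
have [x1 x1W x1b] := nconst b (labB b y1) (or_introl erefl).
have [x2 x2W x2b] := nconst b (labB b y0) (or_introl erefl).
have {x1b} [x1b x1g] : labA b x1 = labB b y0 /\ labA g x1 = labB g y1.
  by case: (WP x1 x1W) => // -[e]; rewrite e eqxx in x1b.
have {x2b} [x2b x2g] : labA b x2 = labB b y1 /\ labA g x2 = labB g y0.
  by case: (WP x2 x2W) => // -[e]; rewrite e eqxx in x2b.
exists (labB b y0), (labB b y1), (labB g y1), (labB g y0); split=> //.
- by rewrite eq_sym.
- move=> y yU; case: (agree x1 y x1W yU); case: (agree x2 y x2W yU);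
    rewrite ?x1b ?x1g ?x2b ?x2g => e2 e1.
  + by move: nb01; rewrite e1 e2 eqxx.
  + by left.
  + by right.
  + by move: ng01; rewrite e1 e2 eqxx.
- by exists x1.
- by exists x2.
- by exists y0.
- by exists y1.
Qed.

Lemma config_swap12 R1 R2 R3 : config s r R1 R2 R3 -> config s r R2 R1 R3.
Proof. by case=> ? ? ? ? ? ?; split; rewrite // eq_sym. Qed.

(** A vertex of [U] meets the large type [W1] in one colour only, so if it were weak there, all of
    [W1] would be strong in one class, against the load. Hence [U] is strong and uses up more than
    half of the loads of [b1] and [g1]. Some [x] of [W1] is then weak in both, and [weak_two] gives
    its [r] class all but [2 s] vertices of [B]. *)
Lemma crossed_bigB R1 R2 R3 b1 b2 g1 g2 : config s r R1 R2 R3 ->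
  crossed r b g R1 R2 R3 b1 b2 g1 g2 ->
  s < #|[set x in clsA r R1 :|: clsA r R2 | labA b x == b1]| ->
  s < #|clsB r R1| \/ s < #|clsB r R2|.
Proof.
move=> C D big; set W := clsA r R1 :|: clsA r R2 in big *; set W1 := finset _ in big.
have W1P x : x \in W1 -> [/\ x \in W, labA b x = b1 & labA g x = g1].
  rewrite inE => /andP[xW /eqP eb]; split=> //.
  case: (crossW D xW) => -[] // eb'; have := neq_b D; rewrite -eb -eb' eqxx //.
have red x y : x \in W1 -> y \in clsB r R3 -> labA r x == labB r y = false.
  case/W1P=> xW _ _; rewrite inE => /eqP ->; apply/negbTE; rewrite eq_sym.
  by case: (W_red xW) => ->; [exact: (neq31 C)|exact: (neq32 C)].
have Ustrong y : y \in clsB r R3 -> y \in strB b b1 :|: strB g g1.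
  move=> yU; apply: contraT; rewrite in_setU negb_or => /andP[yb yg].
  have := crossU D yU => -[[eb eg]|[eb eg]].
    have : #|W1| <= #|strA b b1|.
      apply/subset_leq_card/subsetP=> x xW1; have [xW xb xg] := W1P x xW1.
      have := all_joined H x y; rewrite /joined red //= xb eb xg eg (negPf (neq_g D)) eqxx /= orbF.
      by move: yb; rewrite !inE eb eqxx xb eqxx !andbT => /negPf ->; rewrite orbF.
    by have := loadb H b1; lia.
  have : #|W1| <= #|strA g g1|.
    apply/subset_leq_card/subsetP=> x xW1; have [xW xb xg] := W1P x xW1.
    have := all_joined H x y; rewrite /joined red //= xb eb xg eg (negPf (neq_b D)) eqxx /=.
    by move: yg; rewrite !inE eg eqxx xg eqxx !andbT => /negPf ->; rewrite orbF.
  by have := loadg H g1; lia.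
have lb := loadb H b1; have lg := loadg H g1; have b3 := bigB3 C.
have cU : #|clsB r R3| <= #|strB b b1| + #|strB g g1|.
  apply: leq_trans (leq_card_setU _ _); apply/subset_leq_card/subsetP; exact: Ustrong.
have [x xW1] : exists2 x, x \in W1 & x \notin strA b b1 :|: strA g g1.
  apply/subsetPn; apply/negP => /subset_leq_card.
  by have := leq_of_leqif (leq_card_setU (strA b b1) (strA g g1)); lia.
have [xW xb xg] := W1P x xW1.
rewrite !inE xb xg !eqxx !andbT negb_or => /andP[xcb xcg].
have [_ hx] := weak_two H xcb xcg; rewrite xb xg in hx.
suff : s < #|clsB r (labA r x)| by case: (W_red xW) => ->; [left|right].
have e : #|clsB r (labA r x) :|: (strB b b1 :|: strB g g1)| = #|B|.
  rewrite -cardsT; congr #|pred_of_set _|; apply/setP=> y; rewrite in_setT in_setU.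
  case: (boolP (y \in strB b b1 :|: _)) => [_|]; first by rewrite orbT.
  by rewrite in_setU negb_or => /andP[yb yg]; rewrite inE hx ?eqxx.
have := leq_of_leqif (leq_card_setU (clsB r (labA r x)) (strB b b1 :|: strB g g1)).
have := leq_of_leqif (leq_card_setU (strB b b1) (strB g g1)).
by rewrite e (sizeB H); lia.
Qed.
End Crossed.

Definition str4A (A B K : finType) (b g : colour A B K) b1 b2 g1 g2 : {set A} :=
  strA b b1 :|: strA b b2 :|: (strA g g1 :|: strA g g2).

(** * Counting when one class is big on both sides *)

Section HalfCount.
Variables (A B K : finType) (s : nat) (r b g : colour A B K).
Hypothesis H : covered_by s r b g.
Variables (R1 R2 R3 b1 b2 g1 g2 : K).
Hypothesis C : config s r R1 R2 R3.
Hypothesis C' : config s (swapc r) R1 R3 R2.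
Let W := clsA r R1 :|: clsA r R2.
Let WB := clsB r R1 :|: clsB r R3.
Let S := str4A b g b1 b2 g1 g2.
Let SB := str4A (swapc b) (swapc g) b1 b2 g1 g2.
Hypothesis labW : forall x, x \in W ->
  (labA b x = b1 \/ labA b x = b2) /\ (labA g x = g1 \/ labA g x = g2).
Hypothesis labWB : forall y, y \in WB ->
  (labB b y = b1 \/ labB b y = b2) /\ (labB g y = g1 \/ labB g y = g2).

Lemma in_str4A x : x \in S =
  (x \in covA b) && ((labA b x == b1) || (labA b x == b2)) ||
  (x \in covA g) && ((labA g x == g1) || (labA g x == g2)).
Proof. by rewrite !inE; case: (x \in covA b); case: (x \in covA g). Qed.

(** A vertex of [W] weak in [b] and [g] has an [r] class that is big on [B]; were it [R2], three
    classes would be big on [B]. *)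
Lemma W_rest x : x \in W -> x \notin S -> x \in strA r R1.
Proof.
move=> xW; have [lb lg] := labW xW; rewrite in_str4A.
have -> : (labA b x == b1) || (labA b x == b2) by case: lb => ->; rewrite eqxx ?orbT.
have -> : (labA g x == g1) || (labA g x == g2) by case: lg => ->; rewrite eqxx ?orbT.
rewrite !andbT negb_or => /andP[xb xg]; have [xr hx] := weak_two H xb xg.
have big : s < #|clsB r (labA r x)|.
  set X := strB b (labA b x) :|: strB g (labA g x).
  have e : #|clsB r (labA r x) :|: X| = #|B|.
    rewrite -cardsT; congr #|pred_of_set _|; apply/setP=> y; rewrite in_setT in_setU.
    case: (boolP (y \in X)) => [_|]; first by rewrite orbT.
    by rewrite in_setU negb_or => /andP[yb yg]; rewrite inE hx ?eqxx.
  have := leq_of_leqif (leq_card_setU (clsB r (labA r x)) X).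
  have := leq_of_leqif (leq_card_setU (strB b (labA b x)) (strB g (labA g x))).
  have := loadb H (labA b x); have := loadg H (labA g x).
  by rewrite e -/X (sizeB H); lia.
rewrite inE xr /=; case: (W_red xW) big => -> // big.
by case: (not_three_bigB H (neq12 C) _ _ (bigA1 C') big (bigB3 C)); rewrite eq_sym; [exact: (neq31 C)|exact: (neq32 C)].
Qed.

(** The class in which [z] is strong is big on [B]. For [b] and [g] it meets [WB], so it would be
    one of the four classes of [S]; for [r] only [R3] is left outside [W]. *)
Lemma offW_rest z : z \notin W -> z \notin S -> z \in strA r R3.
Proof.
rewrite in_str4A !inE !negb_or => /andP[z1 z2] /andP[zb zg].
have HS := covered_swap H.
have [[zr]|[zc]|[zc]] := strong_big H z.
- move/(bigA_red HS C') => -[e|->]; last by rewrite zr eqxx.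
  by rewrite e eqxx in z1.
- move/(bigA_meetsW HS C' (c := swapc b)) => -[y yW /= e].
  by have [[l|l] _] := labWB yW; rewrite zc -e l eqxx ?orbT in zb.
- move/(bigA_meetsW HS C' (c := swapc g)) => -[y yW /= e].
  by have [_ [l|l]] := labWB yW; rewrite zc -e l eqxx ?orbT in zg.
Qed.

(** By [offW_rest] the vertex [z] has [r] label [R3], so it is joined to [y] in [b] or [g], and not
    through its own membership in a cover. *)
Lemma offW_covers z y : z \notin W -> z \notin S -> y \in clsB r R1 -> y \in SB.
Proof.
move=> zW zS yR; have := offW_rest zW zS; rewrite inE => /andP[_ /eqP zR].
have yW : y \in WB by rewrite in_setU yR.
have [lb lg] := labWB yW.
move: zS; rewrite in_str4A negb_or /SB !inE /= => /andP[zb zg].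
move: yR; rewrite inE => /eqP yR.
have := all_joined H z y; rewrite /joined zR yR (negPf (neq31 C)) /=.
case/orP=> /andP[/eqP e /orP[zc|yc]].
- by case: lb => l; rewrite zc e l eqxx ?orbT in zb.
- by case: lb => ->; rewrite yc eqxx ?orbT.
- by case: lg => l; rewrite zc e l eqxx ?orbT in zg.
- by case: lg => ->; rewrite yc eqxx ?orbT.
Qed.
End HalfCount.

Section Absurd.
Variables (A B K : finType) (s : nat).

(** The strong parts [SA] and [SB] of the four [b] and [g] classes have at most [4 s] vertices
    together. If there are vertices outside [W] and [SA], and outside [WB] and [SB], then
    [offW_covers] puts [WB] into [SB] and [W] into [SA], which needs [4 s + 4]. Otherwise the load
    of [R1] and fewer than [s] vertices off [W] or [WB] complete the cover of all [6 s + 2]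
    vertices. *)
Lemma crossed_absurd (r b g : colour A B K) R1 R2 R3 b1 b2 g1 g2 :
  covered_by s r b g -> config s r R1 R2 R3 -> crossed r b g R1 R2 R3 b1 b2 g1 g2 ->
  s < #|clsB r R1| -> False.
Proof.
move=> H C D bigB1.
have HS := covered_swap H.
have C' : config s (swapc r) R1 R3 R2.
  split=> /=; [rewrite eq_sym; exact: (neq31 C)|rewrite eq_sym; exact: (neq12 C)
    |rewrite eq_sym; exact: (neq32 C)|exact: bigB1|exact: (bigB3 C)|exact: (bigA2 C)].
have C'' : config s (swapc (swapc r)) R1 R2 R3.
  by split; [exact: (neq12 C)|exact: (neq31 C)|exact: (neq32 C)|exact: (bigA1 C)|exact: (bigA2 C)|exact: (bigB3 C)].
set W := clsA r R1 :|: clsA r R2; set WB := clsB r R1 :|: clsB r R3.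
have labW x : x \in W ->
    (labA b x = b1 \/ labA b x = b2) /\ (labA g x = g1 \/ labA g x = g2).
  by move=> /(crossW D)[][-> ->]; split; by [left|right].
have labWB y : y \in WB ->
    (labB b y = b1 \/ labB b y = b2) /\ (labB g y = g1 \/ labB g y = g2).
  (* The swapped configuration is crossed too. Its labels are again [b1], [b2], [g1], [g2], because
     [y1] and [y2] in [U], a part of [WB], already show all four. *)
  have [b1' [b2' [g1' [g2' D']]]] := config_crossed HS C'.
  have [y1 y1U y1b] := U12 D; have [y2 y2U y2b] := U21 D.
  have y1g : labB g y1 = g2.
    by case: (crossU D y1U) => -[] // e; have := neq_b D; rewrite -y1b -e eqxx.
  have y2g : labB g y2 = g1.
    by case: (crossU D y2U) => -[] // e; have := neq_b D; rewrite -y2b -e eqxx.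
  have y1W : y1 \in WB by rewrite in_setU y1U orbT.
  have y2W : y2 \in WB by rewrite in_setU y2U orbT.
  have h1 := crossW D' y1W; have h2 := crossW D' y2W.
  rewrite /= y1b y1g in h1; rewrite /= y2b y2g in h2.
  move=> yW; have /= h := crossW D' yW; have neq_b' := neq_b D.
  case: h1 h2 => -[e1 f1] [[e2 f2]|[e2 f2]]; first by rewrite e1 e2 eqxx in neq_b'.
  - by rewrite e1 f1 e2 f2; case: h => -[-> ->]; split; by [left|right].
  - by rewrite e1 f1 e2 f2; case: h => -[-> ->]; split; by [left|right].
  - by rewrite e1 e2 eqxx in neq_b'.
set SA := str4A b g b1 b2 g1 g2; set SB := str4A (swapc b) (swapc g) b1 b2 g1 g2.
have cS : #|SA| + #|SB| <= 4 * s.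
  have cardU (T : finType) (X Y X' Y' : {set T}) :
    #|X :|: Y :|: (X' :|: Y')| <= #|X| + #|Y| + (#|X'| + #|Y'|).
    by apply: leq_trans (leq_card_setU _ _) _; rewrite leq_add ?leq_card_setU.
  have hA : #|SA| <= _ := cardU _ (strA b b1) (strA b b2) (strA g g1) (strA g g2).
  have hB : #|SB| <= _ := cardU _ (strB b b1) (strB b b2) (strB g g1) (strB g g2).
  have := loadb H b1; have := loadb H b2; have := loadg H g1; have := loadg H g2; lia.
have WR x : x \in W -> x \notin SA -> x \in strA r R1 := W_rest H C C' labW (x := x).
have WBR y : y \in WB -> y \notin SB -> y \in strB r R1 := W_rest HS C' C'' labWB (x := y).
have offA : #|~: W| < s := size_offW H C.
have offB : #|~: WB| < s := size_offW HS C'.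
have cW : 2 * s + 2 <= #|W| := sizeW C.
have cWB : 2 * s + 2 <= #|WB| := sizeW C'.
have lr := loadr H R1.
have cA := sizeA H; have cB := sizeB H.
have [z zP|noz] := pickP [pred z | (z \notin W) && (z \notin SA)]; last first.
  have h1 : #|A| <= #|SA| + #|strA r R1|.
    apply: leq_trans (leq_card_setU _ _); rewrite -cardsT.
    apply/subset_leq_card/subsetP=> x _; rewrite in_setU.
    case: (boolP (x \in SA)) => //= xS; apply: WR => //.
    by have := noz x; rewrite /= xS andbT => /negbFE.
  have h2 : #|B| <= #|SB| + #|strB r R1| + #|~: WB|.
    apply: leq_trans (leq_card_setU3 _ _ _); rewrite -cardsT.
    apply/subset_leq_card/subsetP=> y _; rewrite 2!in_setU in_setC.
    case: (boolP (y \in SB)) => //= yS; case: (boolP (y \in WB)) => yW; last by rewrite orbT.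
    by rewrite WBR.
  by move: h1 h2 cA cB cS lr offB; clear; lia.
have [y yP|noy] := pickP [pred y | (y \notin WB) && (y \notin SB)]; last first.
  have h1 : #|B| <= #|SB| + #|strB r R1|.
    apply: leq_trans (leq_card_setU _ _); rewrite -cardsT.
    apply/subset_leq_card/subsetP=> x _; rewrite in_setU.
    case: (boolP (x \in SB)) => //= xS; apply: WBR => //.
    by have := noy x; rewrite /= xS andbT => /negbFE.
  have h2 : #|A| <= #|SA| + #|strA r R1| + #|~: W|.
    apply: leq_trans (leq_card_setU3 _ _ _); rewrite -cardsT.
    apply/subset_leq_card/subsetP=> x _; rewrite 2!in_setU in_setC.
    case: (boolP (x \in SA)) => //= yS; case: (boolP (x \in W)) => yW; last by rewrite orbT.
    by rewrite WR.
  by move: h1 h2 cA cB cS lr offA; clear; lia.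
have [zW zS] := andP zP; have [yW yS] := andP yP.
have h1 : #|WB| <= #|SB|.
  apply/subset_leq_card/subsetP=> u uW; apply: contraT => uS.
  have := WBR u uW uS; rewrite inE => /andP[_ uR].
  by rewrite (offW_covers H C C' labWB zW zS) ?inE // in uS.
have h2 : #|W| <= #|SA|.
  apply/subset_leq_card/subsetP=> u uW; apply: contraT => uS.
  have := WR u uW uS; rewrite inE => /andP[_ uR].
  have uK : u \in clsB (swapc r) R1 by rewrite inE.
  by have := offW_covers HS C' C'' labW yW yS uK; rewrite [_ \in _](negPf uS).
by move: h1 h2 cW cWB cS; clear; lia.
Qed.

(** One of the two types has more than [s] of the at least [2 s + 2] vertices of [W], so by
    [crossed_bigB] the class [R1] or [R2] is big on both sides. *)
Lemma config_absurd (r b g : colour A B K) R1 R2 R3 :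
  covered_by s r b g -> config s r R1 R2 R3 -> False.
Proof.
move=> H C; have [b1 [b2 [g1 [g2 D]]]] := config_crossed H C.
have D21 : crossed r b g R1 R2 R3 b2 b1 g2 g1.
  case: D => n1 n2 h1 h2 h3 h4 h5 h6; split=> //; rewrite 1?eq_sym //.
    by move=> x /h1[]; [right|left].
  by move=> x /h2[]; [right|left].
have big : s < #|clsB r R1| \/ s < #|clsB r R2|.
  pose W := clsA r R1 :|: clsA r R2.
  have cW : 2 * s + 2 <= #|W| := sizeW C.
  have [h|h] := ltnP s #|[set x in W | labA b x == b1]|.
    by apply: (crossed_bigB H C D); apply: h.
  apply: (crossed_bigB H C D21).
  have : #|W| <= #|[set x in W | labA b x == b1]| + #|[set x in W | labA b x == b2]|.
    apply: leq_trans (leq_card_setU _ _); apply/subset_leq_card/subsetP=> x xW.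
    by rewrite in_setU !(inE, xW) /=; case: (crossW D xW) => -[-> _]; rewrite eqxx ?orbT.
  by rewrite -/W; move: h cW; clear; lia.
case: big => big; first exact: crossed_absurd H C D big.
have [b1' [b2' [g1' [g2' D']]]] := config_crossed H (config_swap12 C).
exact: crossed_absurd H (config_swap12 C) D' big.
Qed.

End Absurd.

(** Three big classes are either big on the same side, too many for [3 s + 1] vertices, or two on
    one side and one on the other, a configuration. *)
Lemma at_most_two_big (A B K : finType) s (r b g : colour A B K) : covered_by s r b g ->
  #|[set k | (s < #|clsA r k|) || (s < #|clsB r k|)]| <= 2.
Proof.
move=> H; rewrite leqNgt; apply/negP => /card_gt2P[x [y [z [[xS yS zS] [nxy nyz nzx]]]]].
rewrite !inE in xS yS zS.
have nyx : y != x by rewrite eq_sym.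
have nzy : z != y by rewrite eq_sym.
have nxz : x != z by rewrite eq_sym.
have HS := covered_swap H.
have absA k1 k2 k3 : k1 != k2 -> k3 != k1 -> k3 != k2 -> s < #|clsA r k1| ->
    s < #|clsA r k2| -> s < #|clsB r k3| -> False.
  by move=> *; apply: (@config_absurd A B K s r b g k1 k2 k3 H); split.
have absB k1 k2 k3 : k1 != k2 -> k3 != k1 -> k3 != k2 -> s < #|clsB r k1| ->
    s < #|clsB r k2| -> s < #|clsA r k3| -> False.
  by move=> *; apply: (@config_absurd B A K s _ _ _ k1 k2 k3 HS); split.
have n3A := not_three_bigA H; have n3B := not_three_bigB H.
case/orP: xS => xS; case/orP: yS => yS; case/orP: zS => zS.
- exact: (n3A x y z).
- exact: (absA x y z).
- exact: (absA x z y).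
- exact: (absB y z x).
- exact: (absA y z x).
- exact: (absB x z y).
- exact: (absB x y z).
- exact: (n3B x y z).
Qed.

(* By [strong_big] the strong parts of the big classes contain all vertices; there
   are at most six such parts, of size at most [s], for [6 s + 2] vertices. *)
Lemma not_covered_by (A B K : finType) s (r b g : colour A B K) : ~ covered_by s r b g.
Proof.
move=> H.
pose big (c : colour A B K) := [set k | (s < #|clsA c k|) || (s < #|clsB c k|)].
have tr := at_most_two_big H; have tb := at_most_two_big (covered_brg H).
have tg := at_most_two_big (covered_brg (covered_rbg H)).
have HS := covered_swap H.
pose SA c := \bigcup_(k in big c) strA c k; pose SB c := \bigcup_(k in big c) strB c k.
have cover c : (forall k, #|strA c k| + #|strB c k| <= s) -> #|big c| <= 2 ->
    #|SA c| + #|SB c| <= 2 * s.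
  move=> load c2; apply: (@leq_trans (\sum_(k in big c) (#|strA c k| + #|strB c k|))).
    rewrite big_split leq_add //=; [pose f := strA c|pose f := strB c].
      by rewrite /SA; elim/big_rec2: _ => [|k m X _ h]; rewrite ?cards0 // (leq_trans (leq_card_setU _ _)) // leq_add2l.
    by rewrite /SB; elim/big_rec2: _ => [|k m X _ h]; rewrite ?cards0 // (leq_trans (leq_card_setU _ _)) // leq_add2l.
  apply: (@leq_trans (\sum_(k in big c) s)); first by apply: leq_sum => k _.
  by rewrite sum_nat_const leq_mul2r c2 orbT.
have hr := cover r (loadr H) tr; have hb := cover b (loadb H) tb.
have hg := cover g (loadg H) tg.
have hA : #|A| <= #|SA r| + #|SA b| + #|SA g|.
  apply: leq_trans (leq_card_setU3 _ _ _); rewrite -cardsT.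
  apply/subset_leq_card/subsetP=> x _; rewrite 2!in_setU.
  have hit c : x \in covA c /\ s < #|clsB c (labA c x)| -> x \in SA c.
    by move=> [xc h]; apply/bigcupP; exists (labA c x); rewrite !inE ?h ?orbT // xc eqxx.
  by have [/hit ->|/hit ->|/hit ->] := strong_big H x; rewrite ?orbT.
have hB : #|B| <= #|SB r| + #|SB b| + #|SB g|.
  apply: leq_trans (leq_card_setU3 _ _ _); rewrite -cardsT.
  apply/subset_leq_card/subsetP=> y _; rewrite 2!in_setU.
  have hit c : y \in covB c /\ s < #|clsA c (labB c y)| -> y \in SB c.
    by move=> [yc h]; apply/bigcupP; exists (labB c y); rewrite !inE ?h ?orbT // yc eqxx.
  by have [/hit ->|/hit ->|/hit ->] := strong_big HS y; rewrite ?orbT.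
by move: hr hb hg hA hB; rewrite (sizeA H) (sizeB H); clear; lia.
Qed.

Import Order.TTheory GRing.Theory Num.Theory.

(** * Random layers and the reservoir *)

Section Averages.
Local Open Scope ring_scope.

Section Moments.
Variables (R : comRingType) (I O : finType).

Lemma sum_ffun1 (i : I) (G : O -> R) :
  \sum_(f : {ffun I -> O}) G (f i) = #|O|%:R ^+ #|I|.-1 * \sum_o G o.
Proof.
pose F k o := if k == i then G o else 1.
transitivity (\sum_(f : {ffun I -> O}) \prod_k F k (f k)).
  apply: eq_bigr => f _; rewrite (bigD1 i) //= big1 => [|k /negPf ki].
    by rewrite /F eqxx mulr1.
  by rewrite /F ki.
rewrite -bigA_distr_bigA (bigD1 i) //= mulrC; congr (_ * _).
  rewrite (eq_bigr (fun=> #|O|%:R)) => [|k /negPf ki].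
    rewrite prodr_const; congr (_ ^+ _).
    by rewrite -(cardC1 i); apply: eq_card => k; rewrite !inE.
  by rewrite /F ki sumr_const.
by apply: eq_bigr => o _; rewrite /F eqxx.
Qed.

Lemma sum_ffun2_eq0 (u : I -> O -> R) (i j : I) :
  i != j -> \sum_o u i o = 0 -> \sum_(f : {ffun I -> O}) u i (f i) * u j (f j) = 0.
Proof.
move=> ij ui.
pose F k o := (if k == i then u i o else 1) * (if k == j then u j o else 1).
transitivity (\sum_(f : {ffun I -> O}) \prod_k F k (f k)).
  apply: eq_bigr => f _; rewrite big_split /= (bigD1 i) //= big1 => [|k /negPf ->//].
  rewrite [X in _ = _ * X](bigD1 j) //= [X in _ = _ * (_ * X)]big1 => [|k /negPf ->//].
  by rewrite !eqxx !mulr1.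
rewrite -bigA_distr_bigA (bigD1 i) //= (eq_bigr (u i)) ?ui ?mul0r // => o _.
by rewrite /F eqxx (negPf ij) mulr1.
Qed.

(** Variance of a sum of independent centred variables, multiplied by the number of functions. *)
Lemma second_moment (u : I -> O -> R) :
  (forall i, \sum_o u i o = 0) ->
  \sum_(f : {ffun I -> O}) (\sum_i u i (f i)) ^+ 2 =
  #|O|%:R ^+ #|I|.-1 * \sum_i \sum_o u i o ^+ 2.
Proof.
move=> u0; under eq_bigr => f _ do rewrite expr2 big_distrl /=.
rewrite exchange_big mulr_sumr; apply: eq_bigr => i _.
under eq_bigr => f _ do rewrite mulr_sumr.
rewrite exchange_big (bigD1 i) //= [X in _ + X]big1 => [|j ji].
  by rewrite addr0 -(sum_ffun1 i).
by rewrite sum_ffun2_eq0 // eq_sym.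
Qed.

End Moments.

Lemma exists_le_avg (R : realDomainType) (T : finType) (F : T -> R) (c : R) :
  (0 < #|T|)%N -> \sum_x F x <= c * #|T|%:R -> exists x, F x <= c.
Proof.
move=> T0 le; apply/existsP; apply: contraLR le; rewrite negb_exists -ltNge.
move=> /forallP lt; rewrite mulr_natr -sumr_const; have [x0 _] := card_gt0P T0.
rewrite (bigD1 x0) //= [ltRHS](bigD1 x0) //=.
apply: ltr_leD; first by rewrite ltNge.
by apply: ler_sum => x _; rewrite ltW // ltNge.
Qed.

End Averages.

(** * Disjoint paths through random layers *)

Section RandomLayers.
Local Open Scope ring_scope.
Variables (V : finType) (f : rel V) (side : V -> bool) (l : nat).
Hypotheses (f_sym : symmetric f) (f_bip : forall v w, f v w -> side v != side w).
Notation L := l.+1.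

Definition deg v : nat := #|[set w | f v w]|.
Definition cdeg (phi : {ffun V -> 'I_L}) v (j : 'I_L) : nat :=
  #|[set w | f v w & phi w == j]|.
Definition cerr phi v j : rat := (cdeg phi v j)%:R - (deg v)%:R / L%:R.

(** First moment: for a uniform [phi], each vertex [w] contributes variance at most [1 / L] to
    [cerr phi v j], which sums over [w], [j] and [v] to at most [#|V| ^ 2]. *)
Lemma balanced_classes :
  exists phi, \sum_v \sum_j cerr phi v j ^+ 2 <= #|V|%:R ^+ 2.
Proof.
apply: exists_le_avg; first by rewrite card_ffun card_ord expn_gt0.
rewrite exchange_big /= card_ffun card_ord.
have [V0|V_gt0] := posnP #|V|.
  by rewrite big1 ?V0 ?expr0n ?mul0r // => v; move/card0_eq/(_ v): V0.
have L0 : (L%:R : rat) != 0 by rewrite pnatr_eq0.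
pose u v (j : 'I_L) w (o : 'I_L) : rat := (f v w)%:R * ((o == j)%:R - L%:R^-1).
have cerrE phi v j : cerr phi v j = \sum_w u v j w (phi w).
  rewrite /cerr /u; under eq_bigr => w _ do rewrite mulrBr.
  rewrite sumrB -mulr_suml; congr (_ - _ * _).
    rewrite /cdeg -sum1_card natr_sum big_mkcond /=; apply: eq_bigr => w _.
    by rewrite !inE; case: (f v w); case: (_ == _); rewrite ?(mul1r, mul0r).
  rewrite /deg -sum1_card natr_sum big_mkcond /=; apply: eq_bigr => w _.
  by rewrite !inE; case: (f v w).
have sum_eq j : \sum_(o < L) (o == j)%:R = 1 :> rat.
  by rewrite (bigD1 j) //= eqxx big1 ?addr0 // => i /negPf ->.
have u0 v j w : \sum_o u v j w o = 0.
  rewrite /u -mulr_sumr sumrB sum_eq sumr_const card_ord -(mulr_natr L%:R^-1).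
  by rewrite mulVf // subrr mulr0.
have u2 v j w : \sum_o u v j w o ^+ 2 <= 1.
  rewrite /u; under eq_bigr => o _ do rewrite exprMn; rewrite -mulr_sumr.
  have -> : \sum_(o < L) ((o == j)%:R - L%:R^-1) ^+ 2 = 1 - L%:R^-1 :> rat.
    transitivity (\sum_(o < L) ((o == j)%:R * (1 - 2 * L%:R^-1) + L%:R^-1 ^+ 2) : rat).
      by apply: eq_bigr => o _; case: (o == j) => /=; ring.
    rewrite big_split /= -mulr_suml sum_eq sumr_const card_ord -(mulr_natr (L%:R^-1 ^+ 2)).
    have : L%:R * L%:R^-1 = 1 :> rat by rewrite mulfV.
    move: (L%:R : rat) => q; move: q^-1 => p qp.
    by rewrite mul1r expr2 -mulrA (mulrC p q) qp; ring.
  have : 0 <= (L%:R^-1 : rat) by rewrite invr_ge0.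
  move: (L%:R^-1 : rat) => p p0.
  case: (f v w) => /=; rewrite ?(expr1n, expr0n, mul1r, mul0r) //=; lra.
have bound v : \sum_(phi : {ffun V -> 'I_L}) \sum_j cerr phi v j ^+ 2 <=
    #|V|%:R * (L ^ #|V|)%:R.
  rewrite exchange_big /=.
  apply: (@le_trans _ _ (\sum_(j < L) #|'I_L|%:R ^+ #|V|.-1 * #|V|%:R)).
    apply: ler_sum => j _; under eq_bigr => phi _ do rewrite cerrE.
    rewrite second_moment // ler_wpM2l ?exprn_ge0 //.
    by rewrite -sumr_const; apply: ler_sum => w _; apply: u2.
  rewrite sumr_const card_ord -[X in X <= _]mulr_natr mulrAC -exprSr prednK //.
  by rewrite -natrX mulrC.
apply: le_trans (ler_sum _ (fun v _ => bound v)) _.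
by rewrite sumr_const -[X in X <= _]mulr_natr expr2 mulrAC.
Qed.

(* If [S] separates the first layer from the last, let [Z] be the set reachable
   from the first layer. As every vertex has about [deg v / L] neighbours in each
   class, the total degree of [Z] drops by at most the degree of [S] from one
   layer to the next, up to an error controlled by [balanced_classes]. *)
Lemma layered_paths (d t : nat) (tau : rat) :
  (0 < d)%N -> (forall v, deg v <= d)%N -> 0 < tau ->
  3 * L%:R * (#|V|%:R ^+ 2 / tau + #|V|%:R * L%:R * tau) + (d * t)%:R <=
    (\sum_(v | side v) deg v)%:R / L%:R ->
  exists P : 'I_t -> nat -> V,
    [/\ forall i j, (j < L.*2)%N -> side (P i j) = odd j,
        forall i j, (j.+1 < L.*2)%N -> f (P i j) (P i j.+1) &
        forall i i' j j', (j < L.*2)%N -> (j' < L.*2)%N -> P i j = P i' j' ->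
          i = i' /\ j = j'].
Proof.
move=> d_gt0 degd tau0 hE.
have [phi hphi] := balanced_classes.
(* Sides alternate along a path, so the parity of a layer is the side and its half is the random
   class. *)
pose lay v : nat := (side v + (phi v).*2)%N.
have [[P [Pl Pr Pinj]]|[S [Z [ltS Z0 Zl Zr]]]] := layered_menger f lay l.*2 t.
  have Pl' i j : (j < L.*2)%N -> lay (P i j) = j.
    by move=> lj; apply: Pl; rewrite doubleS ltnS in lj.
  exists P; split=> [i j lj|i j lj|i i' j j' lj lj' e].
  - by rewrite -[in RHS](Pl' i j lj) oddD odd_double addbF oddb.
  - by apply: Pr; rewrite doubleS ltnS in lj.
  - have ejj : j = j' by rewrite -(Pl' i j) // e Pl'.
    by split=> //; apply: (Pinj i i' j); rewrite ?e ?ejj //; rewrite doubleS ltnS in lj'.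
exfalso.
pose err v : rat := \sum_j `|cerr phi v j|.
pose X : rat := \sum_v err v.
have err0 v : 0 <= err v by apply: sumr_ge0.
(* The inequality [|a| <= a ^ 2 / tau + tau] passes from squares to absolute values, a rational
   substitute for Cauchy-Schwarz. *)
have XE : X <= #|V|%:R ^+ 2 / tau + #|V|%:R * L%:R * tau.
  have amgm (a : rat) : `|a| <= a ^+ 2 / tau + tau.
    have -> : a ^+ 2 = `|a| ^+ 2 by rewrite real_normK ?num_real.
    have := normr_ge0 a; move: `|a| => b b0.
    have [?|tb] := leP b tau; first by rewrite ler_wpDl // divr_ge0 ?sqr_ge0 // ltW.
    rewrite ler_wpDr ?(ltW tau0) // ler_pdivlMr // expr2 ler_wpM2l // ltW //.
  apply: (@le_trans _ _ (\sum_v \sum_j (cerr phi v j ^+ 2 / tau + tau))).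
    by apply: ler_sum => v _; apply: ler_sum => j _.
  under eq_bigr => v _ do rewrite big_split /= -mulr_suml sumr_const card_ord.
  rewrite big_split /= -mulr_suml sumr_const -(mulr_natr _ #|V|) -(mulr_natr tau).
  rewrite lerD //; first by rewrite ler_wpM2r // invr_ge0 ltW.
  by rewrite mulrC mulrA mulrAC.
have errP v j : `|cerr phi v j| <= err v.
  by rewrite /err (bigD1 j) //= lerDl sumr_ge0.
have lo v j : (deg v)%:R / L%:R - err v <= (cdeg phi v j)%:R.
  by have := errP v j; rewrite /cerr ler_norml; move: (_ / _) => q /andP[]; lra.
have hi v j : (cdeg phi v j)%:R <= (deg v)%:R / L%:R + err v.
  by have := errP v j; rewrite /cerr ler_norml; move: (_ / _) => q /andP[]; lra.
pose a i : rat := \sum_(v in Z | lay v == i) (deg v)%:R.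
pose s i : rat := \sum_(v in S | lay v == i) (deg v)%:R.
pose x i : rat := \sum_(v | lay v == i) err v.
(* The edges between two consecutive layers, counted from either end. *)
have cnt i (Y Y' : {set V}) (j j' : 'I_L) :
    (forall v w, v \in Y -> lay v = i -> f v w -> phi w = j ->
       [/\ w \in Y', lay w = i.+1 & phi v = j']) ->
    (\sum_(v in Y | lay v == i) cdeg phi v j <=
     \sum_(w in Y' | lay w == i.+1) cdeg phi w j')%N.
  move=> YY'.
  have cE v k : cdeg phi v k = (\sum_w (f v w && (phi w == k)))%N.
    rewrite /cdeg -sum1_card big_mkcond /=; apply: eq_bigr => w _.
    by rewrite !inE; case: (f v w && _).
  under eq_bigr => v _ do rewrite cE; rewrite exchange_big /=.
  rewrite [leqRHS]big_mkcond; apply: leq_sum => w _.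
  case: ifP => [_|nw].
    rewrite cE [leqLHS]big_mkcond; apply: leq_sum => v _.
    case: ifP => // /andP[vY /eqP lv]; case fvw: (f v w) => //=.
    case: eqP => //= pw; have [_ _ ->] := YY' v w vY lv fvw pw.
    by rewrite f_sym fvw eqxx.
  rewrite big1 // => v /andP[vY /eqP lv]; case fvw: (f v w) => //=.
  case: eqP => //= pw; have [wY lw _] := YY' v w vY lv fvw pw.
  by rewrite wY lw eqxx in nw.
have step i : (i <= l.*2)%N -> a i <= a i.+1 + s i.+1 + L%:R * (x i + x i.+1).
  move=> li; pose j : 'I_L := inord (i.+1)./2; pose j' : 'I_L := inord i./2.
  have := cnt i Z (Z :|: S) j j'.
  have YY' v w : v \in Z -> lay v = i -> f v w -> phi w = j ->
      [/\ w \in Z :|: S, lay w = i.+1 & phi v = j'].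
    move=> vZ lv fvw pw; have lw : lay w = i.+1.
      move: lv; rewrite /lay pw inordK; last by rewrite ltnS; lia.
      by have := f_bip fvw; case: (side v); case: (side w) => //; lia.
    split=> //; first by apply: (Zr v w vZ fvw); rewrite lv.
    apply: val_inj => /=; rewrite inordK; last by rewrite ltnS; lia.
    by move: lv; rewrite /lay; case: (side v); lia.
  move=> /(_ YY').
  rewrite -(ler_nat rat) !natr_sum => hle.
  have h1 : a i / L%:R - x i <= \sum_(v in Z | lay v == i) (cdeg phi v j)%:R.
    rewrite /a mulr_suml; apply: le_trans (ler_sum _ (fun v _ => lo v j)).
    rewrite sumrB lerD2l lerN2 [leLHS]big_mkcond /x [leRHS]big_mkcond /=.
    by apply: ler_sum => v _; case: (v \in Z); case: (lay v == i).
  have h2 : \sum_(v in Z :|: S | lay v == i.+1) (cdeg phi v j')%:R <=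
      (a i.+1 + s i.+1) / L%:R + x i.+1.
    apply: (le_trans (ler_sum _ (fun v _ => hi v j'))).
    rewrite big_split lerD //=.
      rewrite -mulr_suml ler_wpM2r ?invr_ge0 // /a /s.
      rewrite [leLHS]big_mkcond [X in _ <= X + _]big_mkcond.
      rewrite [X in _ <= _ + X]big_mkcond -big_split /=.
      apply: ler_sum => v _; rewrite inE; case: (v \in Z); case: (v \in S) => /=;
      by case: (lay v == _) => /=; rewrite ?addr0 ?add0r ?lerDl ?ler0n.
    rewrite /x [leLHS]big_mkcond [leRHS]big_mkcond /=.
    by apply: ler_sum => v _; case: (v \in _); case: (lay v == _).
  have L0 : (0 : rat) < L%:R by rewrite ltr0n.
  have := le_trans h1 (le_trans hle h2).
  rewrite -(ler_pM2r L0) mulrBl mulrDl !divfK ?gt_eqF //; lra.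
have xX : \sum_(0 <= i < l.*2.+2) x i <= X.
  rewrite /X /x big_mkord; under eq_bigr => i _ do rewrite big_mkcond.
  rewrite exchange_big /=; apply: ler_sum => v _.
  rewrite -big_mkcond sumr_const -mulr_natr ler_piMr // -[1]/(1%:R) ler_nat.
  apply: leq_trans (_ : #|[set inord (lay v) : 'I_l.*2.+2]| <= 1)%N; last by rewrite cards1.
  apply/subset_leq_card/subsetP => i; rewrite !inE => /eqP e.
  by apply/eqP/val_inj; rewrite /= e inordK.
have x0 i : 0 <= x i by apply: sumr_ge0.
have tele : a 0%N <= \sum_(1 <= i < l.*2.+2) s i + 2 * L%:R * X.
  have a_last : a l.*2.+1 = 0.
    rewrite /a big_pred0 // => v; apply/negP => /andP[/Zl lz /eqP e].
    by rewrite e ltnn in lz.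
  suff main n : (n <= l.*2.+1)%N -> a 0%N <= a n + \sum_(1 <= i < n.+1) s i +
      L%:R * (2 * (\sum_(0 <= i < n.+1) x i) - x 0%N - x n).
    have := main _ (leqnn _); rewrite a_last add0r => /le_trans; apply.
    have L0 : 0 <= L%:R :> rat by [].
    rewrite lerD2l; have -> : 2 * L%:R * X = L%:R * (2 * X) by rewrite mulrCA mulrA.
    apply: ler_wpM2l => //.
    have := x0 0%N; have := x0 l.*2.+1; lra.
  elim: n => [|n IH] ln.
    by rewrite big_nil big_nat1 addr0 lerDl mulr_ge0 ?ler0n //; lra.
  apply: le_trans (IH (ltnW ln)) _.
  rewrite [in leRHS]big_nat_recr //= [X in _ <= _ + _ * (2 * X - _ - _)]big_nat_recr //=.
  have := step n; rewrite ltnS in ln; move=> /(_ ln); rewrite !mulrDr !mulrN !mulrA; lra.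
have a0 : (\sum_(v | side v) deg v)%:R / L%:R - X <= a 0%N + s 0%N.
  rewrite natr_sum mulr_suml.
  apply: (@le_trans _ _ (\sum_(w | side w) (cdeg phi w ord0)%:R)).
    apply: le_trans (ler_sum _ (fun v _ => lo v ord0)).
    rewrite sumrB lerD2l lerN2 /X [leLHS]big_mkcond /=.
    by apply: ler_sum => v _; case: (side v).
  have cE v k : cdeg phi v k = (\sum_w (f v w && (phi w == k)))%N.
    rewrite /cdeg -sum1_card big_mkcond /=; apply: eq_bigr => w _.
    by rewrite !inE; case: (f v w && _).
  under eq_bigr => w _ do rewrite cE natr_sum.
  rewrite exchange_big /= /a /s [X in _ <= X + _]big_mkcond [X in _ <= _ + X]big_mkcond.
  rewrite -big_split /=; apply: ler_sum => w _.
  have degE : (deg w)%:R = \sum_v (f w v)%:R :> rat.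
    rewrite /deg -sum1_card natr_sum big_mkcond /=; apply: eq_bigr => v _.
    by rewrite inE; case: (f w v).
  have [lw|lw] := eqVneq (lay w) 0%N.
    rewrite !andbT; apply: (@le_trans _ _ ((deg w)%:R)).
      rewrite degE [leLHS]big_mkcond; apply: ler_sum => v _.
      by rewrite (f_sym v); case: (side v); case: (f w v); case: (phi w == ord0); rewrite /= ?lexx ?ler01.
    have := Z0 w lw; rewrite inE; case: (w \in Z); case: (w \in S) => //=;
      by rewrite ?addr0 ?add0r ?lerDl ?ler0n.
  rewrite !andbF addr0 big1 // => v sv; case fvw: (f v w) => //=.
  case: eqP => //= pw; move: lw; rewrite /lay pw.
  by have := f_bip fvw; rewrite sv; case: (side w).
have sS : \sum_(0 <= i < l.*2.+2) s i <= (d * #|S|)%:R.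
  rewrite big_mkord; under eq_bigr => i _ do rewrite /s big_mkcondr.
  rewrite exchange_big /= mulnC -sum_nat_const natr_sum; apply: ler_sum => v _.
  rewrite -big_mkcond sumr_const.
  apply: (@le_trans _ _ (deg v)%:R); last by rewrite ler_nat.
  rewrite -[X in X <= _]mulr_natr ler_piMr ?ler0n // -[1]/(1%:R) ler_nat.
  apply: leq_trans (_ : #|[set inord (lay v) : 'I_l.*2.+2]| <= 1)%N; last by rewrite cards1.
  apply/subset_leq_card/subsetP => i; rewrite !inE => /eqP e.
  by apply/eqP/val_inj; rewrite /= e inordK.
have dt : (d * #|S|)%:R < (d * t)%:R :> rat by rewrite ltr_nat ltn_pmul2l.
rewrite big_ltn // in sS.
have L1 : 1 <= L%:R :> rat by rewrite ler1n.
have X0 : 0 <= X by apply: sumr_ge0.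
have LX : L%:R * X <= L%:R * (#|V|%:R ^+ 2 / tau + #|V|%:R * L%:R * tau).
  by rewrite ler_wpM2l ?ler0n.
have XL : X <= L%:R * X by rewrite ler_peMl.
have fin (e y b c m D D' p q : rat) : e - y <= b + c -> D < D' -> c + m <= D ->
    0 <= y -> y <= q -> q <= p -> 3 * p + D' <= e -> b <= m + 2 * q -> False.
  by lra.
apply: (fin _ _ _ _ _ _ _ _ _ a0 dt sS X0 XL LX); rewrite mulrA //.
Qed.
End RandomLayers.

Lemma count_words_meet (V : finType) (U : {set V}) n :
  #|V| * count (has [in U]) (words V n) <= n * #|U| * #|V| ^ n.
Proof.
elim: n => [|n IH]; first by rewrite /= !muln0.
suff h : count (has [in U]) (words V n.+1) <=
    #|U| * #|V| ^ n + #|V| * count (has [in U]) (words V n).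
  apply: leq_trans (leq_mul (leqnn #|V|) h) _.
  by rewrite mulnDr !expnS; nia.
rewrite count_words (bigID [in U]) /= leq_add //.
  rewrite -sum_nat_const; apply: leq_sum => w _.
  by rewrite -(size_words V n) count_size.
rewrite -sum_nat_const big_mkcond /=; apply: leq_sum => w _.
by case: ifP => // /negPf wU; apply: sub_count => s /=; rewrite wU.
Qed.

(** * A reservoir of disjoint words chosen by an exponential potential *)

Section GreedyReservoir.
Local Open Scope ring_scope.

Lemma exists_le_avg_seq (R : realDomainType) (T : eqType) (s : seq T) (F : T -> R) c :
  (0 < size s)%N -> \sum_(x <- s) F x <= c * (size s)%:R -> exists2 x, x \in s & F x <= c.
Proof.
case: s => // x0 s _; rewrite (big_nth x0) big_mkord => le.
have [||i hi] := @exists_le_avg R 'I_(size (x0 :: s)) (fun i => F (nth x0 (x0 :: s) i)) c.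
- by rewrite card_ord.
- by rewrite card_ord.
by exists (nth x0 (x0 :: s) i) => //; apply: mem_nth.
Qed.

(** By Bernoulli [(1 + 1/C) ^ C] is at least 2, and its product with the left side is at most 1. *)
Lemma half_pow (C : nat) : (0 < C)%N -> (1 - C%:R^-1) ^+ C <= 2^-1 :> rat.
Proof.
move=> C0; set x : rat := C%:R^-1.
have Cx : C%:R * x = 1 by rewrite mulfV // pnatr_eq0 -lt0n.
have x0 : 0 <= x by rewrite invr_ge0.
have x1 : x <= 1 by rewrite invf_le1 ?ltr0n // ler1n.
have bern n : 1 + n%:R * x <= (1 + x) ^+ n.
  elim: n => [|n IH]; first by rewrite mul0r addr0 expr0.
  rewrite exprS -natr1.
  have h : (1 + x) * (1 + n%:R * x) <= (1 + x) * (1 + x) ^+ n.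
    by rewrite ler_wpM2l // addr_ge0.
  have : 0 <= n%:R * (x * x) by rewrite !mulr_ge0.
  move=> nxx; apply: le_trans h; move: nxx; move: (n%:R : rat) => m; lra.
have h2 : 2 <= (1 + x) ^+ C by apply: le_trans (bern C); rewrite Cx; lra.
have hp : (1 - x) ^+ C * (1 + x) ^+ C <= 1.
  by rewrite -exprMn exprn_ile1 //; nra.
have p0 : 0 <= (1 - x) ^+ C by rewrite exprn_ge0 // subr_ge0.
rewrite -[2^-1]mul1r ler_pdivlMr //; nra.
Qed.

Section Reservoir.
Variables (V Q : finType) (hit : Q -> seq V -> bool) (J kappa : nat).
Hypothesis kappa_gt0 : (0 < kappa)%N.
Hypothesis many : forall q, (#|V| ^ J <= kappa * count (hit q) (words V J))%N.

(** Avoiding the words used before costs at most half of the hitting probability [1 / kappa], and a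
    hit halves its term of the potential. *)
Let theta : rat := (4 * kappa)%:R^-1.

(** A single [q] with fewer than [h] hits already keeps this above [2 ^ -h]. *)
Definition pot (rs : seq (seq V)) : rat := \sum_q (2^-1) ^+ count (hit q) rs.

Definition spread (rs : seq (seq V)) :=
  all (fun s => size s == J) rs && pairwise (fun s t : seq V => ~~ has [in s] t) rs.

(* Some word disjoint from the earlier ones decreases the potential by the
   factor [1 - theta], because an average one does. *)
Lemma greedy k : (0 < #|V|)%N -> (J * (k * J) * (2 * kappa) <= #|V|)%N ->
  exists rs, [/\ size rs = k, spread rs & pot rs <= #|Q|%:R * (1 - theta) ^+ k].
Proof.
move=> V0; elim: k => [|k IH] cap.
  exists [::]; split=> //; rewrite /pot /= expr0 mulr1.
  by rewrite sumr_const.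
have cap' : (J * (k * J) * (2 * kappa) <= #|V|)%N by apply: leq_trans cap; nia.
have [rs [srs /andP[szrs prs] potrs]] := IH cap'.
pose U := [set v | v \in flatten rs].
have cU : (#|U| <= k * J)%N.
  apply: leq_trans (_ : size (flatten rs) <= _)%N.
    by rewrite cardsE card_size.
  rewrite -srs; elim: (rs) szrs => //= s t IH' /andP[/eqP ss /IH'].
  by rewrite size_cat ss mulSn leq_add2l.
pose A := [seq s <- words V J | ~~ has [in U] s].
set W := (#|V| ^ J)%N.
have Wpos : (0 < W)%N by rewrite expn_gt0 V0.
have meet : (2 * kappa * count (has [in U]) (words V J) <= W)%N.
  have := count_words_meet U J; rewrite -/W => h.
  rewrite -(leq_pmul2l V0).
  have : (2 * kappa * (#|V| * count (has [in U]) (words V J)) <= 2 * kappa * (J * #|U| * W))%N.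
    by rewrite leq_mul2l h orbT.
  have : (2 * kappa * (J * #|U|) <= #|V|)%N.
    apply: leq_trans cap'; rewrite mulnC leq_mul2r leq_mul2l cU; lia.
  nia.
have hitA q : (W <= 2 * kappa * count (hit q) A)%N.
  have := many q; rewrite -/W.
  have : (count (hit q) (words V J) <= count (hit q) A + count (has [in U]) (words V J))%N.
    rewrite /A count_filter -count_predUI.
    apply: leq_trans (leq_addr _ _); apply: sub_count => s /=.
    by case: (hit q s); case: (has _ s).
  nia.
have sizeA : (size A <= W)%N by rewrite size_filter /W -(size_words V J) count_size.
have A0 : (0 < size A)%N.
  have := count_predC (has [in U]) (words V J); rewrite size_words -/W.
  have -> : size A = count (predC (has [in U])) (words V J) by rewrite size_filter.
  by move: meet; set c := count _ _; set c' := count _ _; nia.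
pose F s : rat := pot (s :: rs).
have [|s sA Fs] := @exists_le_avg_seq _ _ A F ((1 - theta) * pot rs) A0.
  rewrite /F /pot exchange_big /= mulr_sumr mulr_suml; apply: ler_sum => q _.
  under eq_bigr => s _ do rewrite exprD.
  rewrite -mulr_suml mulrAC ler_wpM2r ?exprn_ge0 //.
  have -> : \sum_(s <- A) (2^-1) ^+ (hit q s) = (size A)%:R - 2^-1 * (count (hit q) A)%:R :> rat.
    elim: (A) => [|s t IH']; first by rewrite big_nil /= mulr0 subr0.
    rewrite big_cons IH' /= natrD -(natr1 (size t)); case: (hit q s) => /=; rewrite ?expr0 ?expr1; lra.
  rewrite mulrBl mul1r lerD2l lerN2 /theta mulrC ler_pdivrMr; last first.
    by rewrite ltr0n muln_gt0.
  have : ((size A)%:R : rat) <= (2 * kappa * count (hit q) A)%:R.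
    by rewrite ler_nat (leq_trans sizeA).
  rewrite !natrM; move: (kappa%:R : rat) ((count _ _)%:R : rat) => a b; nra.
exists (s :: rs); split; rewrite /= ?srs //.
  rewrite /spread /= szrs prs !andbT.
  move: sA; rewrite mem_filter => /andP[sU /mem_words ->]; rewrite eqxx /=.
  apply/allP=> t trs; apply: contra sU => /hasP[v vt vs].
  apply/hasP; exists v => //=; rewrite inE; apply/flattenP; by exists t.
apply: le_trans Fs _; rewrite exprS mulrCA ler_wpM2l //.
by rewrite subr_ge0 invf_le1 ?ltr0n ?muln_gt0 // ler1n muln_gt0.
Qed.

(** Each block of [4 kappa] words halves the potential: [l] blocks cancel its initial value [#|Q|],
    and [h] more bring it down to [2 ^ -h]. *)
Lemma reservoir h l : (0 < #|V|)%N -> (#|Q| <= 2 ^ l)%N ->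
  (J * (4 * kappa * (h + l) * J) * (2 * kappa) <= #|V|)%N ->
  exists rs, [/\ size rs = (4 * kappa * (h + l))%N, spread rs &
    forall q, (h <= count (hit q) rs)%N].
Proof.
move=> V0 Ql cap; have [rs [srs sprs potrs]] := greedy V0 cap.
exists rs; split=> // q.
have pow2 : (1 - theta) ^+ (4 * kappa * (h + l)) <= 2^-1 ^+ (h + l) :> rat.
  rewrite exprM lerXn2r ?nnegrE ?invr_ge0 //; last first.
    by apply: half_pow; rewrite muln_gt0.
  by rewrite exprn_ge0 // subr_ge0 invf_le1 ?ltr0n ?muln_gt0 // ler1n muln_gt0.
have : 2^-1 ^+ count (hit q) rs <= 2^-1 ^+ h :> rat.
  apply: (@le_trans _ _ (pot rs)).
    by rewrite /pot (bigD1 q) //= lerDl sumr_ge0 // => ? _; rewrite exprn_ge0.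
  apply: le_trans potrs _.
  apply: le_trans (ler_wpM2l _ pow2) _ => //.
  rewrite exprD mulrC -mulrA ler_piMr ?exprn_ge0 //.
  apply: (@le_trans _ _ (2^-1 ^+ l * (2 ^ l)%:R)).
    by rewrite ler_wpM2l ?exprn_ge0 // ler_nat.
  by rewrite natrX -exprMn mulVf // expr1n.
by rewrite ler_iXn2l.
Qed.
End Reservoir.

End GreedyReservoir.

(** * Long paths in cut-dense graphs *)

Lemma expn2_gt_sqr (c : nat) : exists v0, forall v, v0 <= v -> v ^ 2 <= 2 ^ (v %/ c.+1).
Proof.
have cube k : 10 <= k -> k ^ 3 <= 2 ^ k.
  elim: k => // k IH; rewrite leq_eqVlt => /orP[/eqP <- //|lk].
  have := IH lk; rewrite !expnS !expn0; nia.
exists (c.+1 * (4 * c.+1 ^ 2 + 10)) => v lv.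
set k := v %/ c.+1.
have lk : 4 * c.+1 ^ 2 + 10 <= k by rewrite leq_divRL // mulnC.
apply: leq_trans (cube k _); last by lia.
have : v < (k.+1) * c.+1 by apply: ltn_ceil.
move: lk; rewrite !expnS !expn0 !muln1 => lk lv'.
have h1 : v * v <= (k.+1 * c.+1) * (k.+1 * c.+1) by apply: leq_mul; apply: ltnW.
apply: leq_trans h1 _.
have h2 : k.+1 * k.+1 <= 2 * (2 * (k * k)) by nia.
have h3 : (k.+1 * k.+1) * (c.+1 * c.+1) <= (4 * (k * k)) * (c.+1 * c.+1).
  by rewrite leq_mul2r; apply/orP; right; lia.
nia.
Qed.

(** The hypothesis of [layered_paths] at [tau = v / q]. The slack [d (m / L - t)] is about
    [d v / (4 g L)], at least about [v ^ 2 / (32 g ^ 3 L)]. The value of [q] makes the error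
    [3 L ^ 2 v ^ 2 / q] a quarter of that; large [v] absorbs the error [3 L v q] and the rounding of
    [t]. *)
Lemma numeric_layers (g L q v d m n t : nat) :
  q = 384 * g ^ 3 * L ^ 3 ->
  0 < g -> 0 < L -> 384 * g ^ 3 * L ^ 2 * q <= v -> 8 * g * L <= v -> v <= 8 * g ^ 2 * d ->
  2 * g * n + v <= 4 * g * m -> 2 * L * t <= n + 2 * L ->
  (3 * L%:R * (v%:R ^+ 2 / (v%:R / q%:R) + v%:R * L%:R * (v%:R / q%:R)) + (d * t)%:R <=
   (d * m)%:R / L%:R :> rat)%R.
Proof.
move=> qE g0 L0 hv1 hv2 hd hm ht.
have q0 : 0 < q by rewrite qE !muln_gt0 ?expn_gt0 ?g0 ?L0.
have v0 : 0 < v by apply: leq_trans hv1; rewrite !muln_gt0 ?expn_gt0 ?g0 ?L0 q0.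
have key : 3 * L ^ 2 * (v * q ^ 2 + L * v ^ 2) + d * t * L * q <= d * m * q.
  have g4 : 0 < 4 * g by lia.
  rewrite -(leq_pmul2l g4).
  have a1 : 4 * g * L * t <= 2 * g * n + 4 * g * L.
    have : g * 2 * (2 * L * t) <= g * 2 * (n + 2 * L) by rewrite leq_mul2l ht orbT.
    lia.
  have a2 : 4 * g * L * t + v <= 4 * g * m + 4 * g * L by lia.
  have a3 : d * q * (4 * g * L * t + v) <= d * q * (4 * g * m + 4 * g * L).
    by rewrite leq_mul2l a2 orbT.
  suff a4 : 12 * g * L ^ 2 * v * q ^ 2 + 12 * g * L ^ 3 * v ^ 2 + 4 * g * L * d * q <= d * q * v.
    move: a3 a4; rewrite !expnS !expn0 !muln1 => a3 a4; lia.
  have b1 : 2 * (4 * g * L * d * q) <= d * q * v.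
    have : d * q * (8 * g * L) <= d * q * v by rewrite leq_mul2l hv2 orbT.
    lia.
  have b0 : q * v * v <= q * v * (8 * g ^ 2 * d) by rewrite leq_mul2l hd orbT.
  have b2 : 4 * (12 * g * L ^ 3 * v ^ 2) <= d * q * v.
    have c : 8 * g ^ 2 * (4 * (12 * g * L ^ 3 * v ^ 2)) = q * v * v.
      by rewrite qE !expnS !expn0 !muln1; lia.
    rewrite -(leq_pmul2l (_ : 0 < 8 * g ^ 2)) ?muln_gt0 ?expn_gt0 ?g0 // c.
    by apply: leq_trans b0 _; lia.
  have b3 : 4 * (12 * g * L ^ 2 * v * q ^ 2) <= d * q * v.
    have c : 8 * g ^ 2 * (4 * (12 * g * L ^ 2 * v * q ^ 2)) <= q * v * v.
      have : q * v * (384 * g ^ 3 * L ^ 2 * q) <= q * v * v by rewrite leq_mul2l hv1 orbT.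
      by rewrite !expnS !expn0 !muln1; lia.
    rewrite -(leq_pmul2l (_ : 0 < 8 * g ^ 2)) ?muln_gt0 ?expn_gt0 ?g0 //.
    by apply: leq_trans c _; apply: leq_trans b0 _; lia.
  lia.
rewrite -(ler_nat rat) in key.
rewrite ler_pdivlMr ?ltr0n //.
have qr : (0 < q%:R :> rat)%R by rewrite ltr0n.
rewrite -(ler_pM2r qr) -[leRHS]natrM.
apply: le_trans key; rewrite le_eqVlt; apply/orP; left; apply/eqP.
rewrite !(natrD, natrM, natrX).
have vr : (v%:R != 0 :> rat)%R by rewrite pnatr_eq0 -lt0n.
move: qr vr; move: (q%:R : rat)%R (v%:R : rat)%R (L%:R : rat)%R (d%:R : rat)%R (t%:R : rat)%R => a b c x y a0 b0.
field; by rewrite b0 gt_eqF.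
Qed.

Definition edges (V : finType) (e : rel V) (Y : {set V}) : {set V * V} :=
  [set p | [&& p.1 \in Y, p.2 \in Y & e p.1 p.2]].

Section LongPath.
Variables (V : finType) (e : rel V) (side : V -> bool) (X : {set V}) (g n : nat).
Hypotheses (e_sym : symmetric e) (e_bip : forall u w, e u w -> side u != side w).
Hypotheses (g_gt0 : 0 < g) (bigX : #|V| <= g * #|X|) (cutX : cut_dense e g X).
Hypothesis robust : forall S : {set V}, 2 * g * #|S| <= g * n + #|V| ->
  #|V| ^ 2 < g ^ 2 * #|edges e (X :\: S)|.

(** Otherwise [C], [D] and the reserved set [R] together stay within the bound of [robust] and leave
    too few edges. [edges] counts ordered pairs while [r] fixes the side of the first vertex, hence
    the factor 2. *)
Lemma dense_subgraph (R : {set V}) d m : 8 * g * #|R| <= #|V| ->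
  4 * g * m <= 2 * g * n + #|V| + 4 * g -> 0 < d -> 2 * g ^ 2 * (d * m) <= #|V| ^ 2 ->
  exists F : {set V * V}, [/\ d * m <= #|F|,
    forall x, x \in F -> [&& x.1 \in X :\: R, x.2 \in X :\: R, e x.1 x.2 & ~~ side x.1],
    forall a, #|[set x in F | x.1 == a]| <= d & forall b, #|[set x in F | x.2 == b]| <= d].
Proof.
move=> hR hm d0 hdm.
pose r a b := [&& a \in X :\: R, b \in X :\: R, e a b & ~~ side a].
have [[F [h1 h2 h3 h4]]|[C [D lt]]] := degree_constrained r (d * m) d0.
  by exists F.
exfalso; move: lt; set E := finset _ => lt.
have ltCD : #|C| + #|D| < m.
  by rewrite -(ltn_pmul2l d0); apply: leq_ltn_trans lt; apply: leq_addr.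
pose S := C :|: D :|: R.
have cS : #|S| <= #|C| + #|D| + #|R|.
  by apply: leq_trans (leq_card_setU _ _) _; rewrite leq_add2r leq_card_setU.
have := robust (S := S); have -> : 2 * g * #|S| <= g * n + #|V| by nia.
move=> /(_ isT).
suff : #|edges e (X :\: S)| <= 2 * #|E|.
  move=> h; have : g ^ 2 * #|edges e (X :\: S)| <= g ^ 2 * (2 * #|E|) by rewrite leq_mul2l h orbT.
  have : g ^ 2 * (2 * #|E|) <= g ^ 2 * (2 * (d * m)).
    rewrite !leq_mul2l; apply/orP; right; apply/ltnW; apply: leq_ltn_trans lt.
    by apply: leq_addl.
  lia.
pose sw (p : V * V) := (p.2, p.1).
have sw_inj : injective sw by move=> [a b] [a' b'] [-> ->].
apply: (@leq_trans #|E :|: sw @: E|); last first.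
  apply: leq_trans (leq_card_setU _ _) _; rewrite card_imset // mul2n -addnn //.
apply/subset_leq_card/subsetP=> -[a b]; rewrite !inE /= !negb_or.
case/and3P=> /andP[/andP[/andP[aC aD] aR] aX] /andP[/andP[/andP[bC bD] bR] bX] eab.
apply/orP; have := e_bip eab; case sa: (side a); case sb: (side b) => // _; last first.
  by left; rewrite /r !inE aR bR aX bX eab sa /= aC bD.
right; apply/imsetP; exists (b, a) => //.
by rewrite inE /= /r !inE aR bR aX bX e_sym eab sb /= bC aD.
Qed.

Lemma robust_size : n < 2 * #|V|.
Proof.
rewrite ltnNge; apply/negP => le.
have := robust (S := setT); rewrite cardsT setDT.
have -> : edges e set0 = set0 by apply/setP=> p; rewrite !inE.
rewrite cards0 muln0 ltn0 => h; suff : false by []; apply: h.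
have : g * (2 * #|V|) <= g * n by rewrite leq_mul2l le orbT.
lia.
Qed.

Lemma disjoint_paths (R : {set V}) l q d m t :
  8 * g * #|R| <= #|V| -> 4 * g * m <= 2 * g * n + #|V| + 4 * g -> 0 < d ->
  2 * g ^ 2 * (d * m) <= #|V| ^ 2 -> q = 384 * g ^ 3 * l.+1 ^ 3 ->
  384 * g ^ 3 * l.+1 ^ 2 * q <= #|V| -> 8 * g * l.+1 <= #|V| -> #|V| <= 8 * g ^ 2 * d ->
  2 * g * n + #|V| <= 4 * g * m -> 2 * l.+1 * t <= n + 2 * l.+1 ->
  exists ts : seq (seq V), [/\ size ts = t, 
    forall s, s \in ts -> size s = l.+1.*2 /\ sorted e s,
    uniq (flatten ts) & {subset flatten ts <= X :\: R}].
Proof.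
move=> hR hm d0 hdm qE hv1 hv2 hd hm' ht.
have [F [Fm FP Fd1 Fd2]] := dense_subgraph hR hm d0 hdm.
pose f : rel V := fun u w => ((u, w) \in F) || ((w, u) \in F).
have f_sym : symmetric f by move=> u w; rewrite /f orbC.
have fe u w : f u w -> [&& u \in X :\: R, w \in X :\: R & e u w].
  by case/orP=> /FP /and4P[/= -> -> ? _] //=; rewrite e_sym.
have f_bip u w : f u w -> side u != side w by case/fe/and3P=> _ _ /e_bip.
have Fside u w : (u, w) \in F -> side u = false /\ side w = true.
  by case/FP/and4P=> /= _ _ /e_bip; case: (side u); case: (side w).
have fdeg u : deg f u <= d.
  case su: (side u).
    apply: leq_trans (Fd2 u); rewrite /deg -(card_imset [set w | f u w] (_ : injective (fun w => (w, u)))).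
      apply/subset_leq_card/subsetP=> _ /imsetP[w + ->]; rewrite !inE eqxx andbT.
      by case/orP=> // /Fside[]; rewrite su.
    by move=> a b [].
  apply: leq_trans (Fd1 u); rewrite /deg -(card_imset [set w | f u w] (_ : injective (fun w => (u, w)))).
    apply/subset_leq_card/subsetP=> _ /imsetP[w + ->]; rewrite !inE eqxx andbT.
    by case/orP=> // /Fside[_]; rewrite su.
  by move=> a b [].
have FE : #|F| <= \sum_(w | side w) deg f w.
  have -> : #|F| = \sum_(w | side w) #|[set x in F | x.2 == w]|.
    rewrite -sum1_card (partition_big (fun x => x.2) side) /=; last first.
      by move=> [u w] /Fside[].
    by apply: eq_bigr => w _; rewrite -sum1_card; apply: eq_bigl => x; rewrite inE.
  apply: leq_sum => w sw.
  have inj : {in [set x in F | x.2 == w] &, injective (fun x : V * V => x.1)}.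
    by move=> [a b] [a' b']; rewrite !inE /= => /andP[_ /eqP ->] /andP[_ /eqP ->] ->.
  rewrite -(card_in_imset inj); apply/subset_leq_card/subsetP=> _ /imsetP[[a b] + ->].
  by rewrite !inE /= /f => /andP[ab /eqP <-]; rewrite ab orbT.
have V0 : 0 < #|V| by apply: leq_trans hv2; rewrite !muln_gt0 g_gt0.
have q0 : 0 < q by rewrite qE !muln_gt0 ?expn_gt0 ?g_gt0.
have num := numeric_layers qE g_gt0 isT hv1 hv2 hd hm' ht.
have [||P [Ps Pf Pinj]] := @layered_paths V f side l f_sym f_bip d t
   (#|V|%:R / q%:R)%R d0 fdeg.
- by rewrite divr_gt0 ?ltr0n.
- apply: le_trans num _; rewrite ler_pM2r ?invr_gt0 ?ltr0n // ler_nat.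
  exact: leq_trans Fm FE.
exists [seq mkseq (P i) l.+1.*2 | i <- enum 'I_t]; split.
- by rewrite size_map size_enum_ord.
- move=> _ /mapP[i _ ->]; rewrite size_mkseq; split=> //.
  rewrite /mkseq; apply/(sortedP (P i 0)) => j; rewrite size_map size_iota => lj.
  rewrite !(nth_map 0) ?size_iota ?(ltnW lj) // !nth_iota ?(ltnW lj) //.
  by have /and3P[] := fe _ _ (Pf i j lj).
- rewrite -[flatten _]/(flatten [seq [seq P i j | j <- iota 0 l.+1.*2] | i <- enum 'I_t]).
  apply: allpairs_uniq; rewrite ?enum_uniq ?iota_uniq //.
  move=> x y /allpairsP[[i j] [_ lj ->]] /allpairsP[[i' j'] [_ lj' ->]] /= e'.
  move: lj lj'; rewrite !mem_iota !add0n => /andP[_ lj] /andP[_ lj'].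
  by have [-> ->] := Pinj i i' j j' lj lj' e'.
- move=> u /flattenP[_ /mapP[i _ ->] /mapP[j + ->]]; rewrite mem_iota add0n /= => lj.
  have [lj1|] := ltnP j.+1 l.+1.*2.
    by have /and3P[] := fe _ _ (Pf i j lj1).
  case: j lj => [|j] lj; first by rewrite doubleS.
  by have /and3P[] := fe _ _ (Pf i j lj).
Qed.
End LongPath.

Lemma size_flatten_const (T : eqType) (ss : seq (seq T)) k :
  (forall s, s \in ss -> size s = k) -> size (flatten ss) = size ss * k.
Proof.
elim: ss => //= s ss IH h; rewrite size_cat h ?mem_head // IH ?mulSn // => u us.
by rewrite h // inE us orbT.
Qed.

Lemma cover_bound g n v m : 0 < g -> n < 2 * v -> (m - 1) * (4 * g) <= 2 * g * n + v ->
  0 < m -> m <= 2 * v.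
Proof.
move=> g0 nv hm m0; rewrite leqNgt; apply/negP => lt.
have h1 : 2 * v * (4 * g) <= (m - 1) * (4 * g) by rewrite leq_mul2r; apply/orP; right; lia.
have h2 : g * n <= g * (2 * v - 1) by rewrite leq_mul2l; apply/orP; right; lia.
nia.
Qed.

(** The tiles have [4 (c + 1)] vertices, so they number about [n / (4 (c + 1))], less than half of
    [v / (c + 1)]; the other half absorbs the rounding. *)
Lemma tiles_le_hits c h n v t : 4 * c.+1 <= v -> v < h.+1 * c.+1 -> n < 2 * v ->
  (t - 1) * (2 * (2 * c.+1)) <= n -> t <= h.
Proof.
move=> h1 h2 h3 h4.
have a : 4 * c.+1 < h.+1 * c.+1 by apply: leq_ltn_trans h2.
have b : (2 * (t - 1)) * c.+1 < h.+1 * c.+1 by lia.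
rewrite !ltn_pmul2r // in a b; lia.
Qed.

Lemma dense_bound g v d m : d * (4 * g ^ 2) <= v -> m <= 2 * v ->
  2 * g ^ 2 * (d * m) <= v ^ 2.
Proof.
move=> h1 h2; have : d * (4 * g ^ 2) * m <= v * (2 * v) by apply: leq_mul.
rewrite -[v ^ 2]mulnn; lia.
Qed.

Lemma long_path (g : nat) : 0 < g -> exists v0, forall (V : finType) (e : rel V)
  (side : V -> bool) (X : {set V}) (n : nat), v0 <= #|V| ->
  symmetric e -> (forall u w, e u w -> side u != side w) ->
  #|V| <= g * #|X| -> cut_dense e g X ->
  (forall S : {set V}, 2 * g * #|S| <= g * n + #|V| ->
    #|V| ^ 2 < g ^ 2 * #|edges e (X :\: S)|) ->
  exists p, [/\ sorted e p, uniq p & n <= size p].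
Proof.
move=> g0.
have sum6 (a b c d e f w : nat) : a + b + c + d + e + f <= w ->
    [/\ a <= w, b <= w, c <= w, d <= w & e + f <= w] by move=> ?; split; lia.
have [J JE] : exists J, J = (8 * g ^ 2).+2 by eexists.
have [k kE] : exists k, k = (2 * g ^ 3) ^ J by eexists.
have J0 : 0 < J by rewrite JE.
have k0 : 0 < k by rewrite kE expn_gt0 muln_gt0 expn_gt0 g0.
(* The reservoir will consist of [8 k h] words of [J] letters, with [h] at most [#|V| / (c + 1)].
   This [c] keeps it below [#|V| / (8 g)] vertices and leaves room for the greedy choice. *)
have [c cE] : exists c, c.+1 = 64 * g * J ^ 2 * k ^ 2.
  by exists (64 * g * J ^ 2 * k ^ 2).-1; rewrite prednK // !muln_gt0 ?expn_gt0 ?g0 ?J0 ?k0.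
have [v1 hv1] := expn2_gt_sqr c.
have [l lE] : exists l, l.+1 = 2 * c.+1 by exists (2 * c.+1).-1.
have [q qE] : exists q, q = 384 * g ^ 3 * l.+1 ^ 3 by eexists.
exists (v1 + 4 * c.+1 + 384 * g ^ 3 * l.+1 ^ 2 * q + 8 * g * l.+1 + 8 * g ^ 2 + 4 * g).
move=> V e side X n /sum6[hva hvb hvc hvd hve] e_sym e_bip bigX cutX robust.
have X4 : 4 <= #|X|.
  rewrite -(leq_pmul2l g0); apply: leq_trans bigX; apply: leq_trans hve; lia.
have /card_gt0P[x0 x0X] : 0 < #|X| by apply: leq_trans X4.
have V0 : 0 < #|V| by apply/card_gt0P; exists x0.
have nV : n < 2 * #|V| by apply: robust_size robust.
set h := #|V| %/ c.+1.
have hle : h * c.+1 <= #|V| by apply: leq_trunc_div.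
have hgt : #|V| < h.+1 * c.+1 by apply: ltn_ceil.
(* Pairs not inside [X] count as hit by every word, so that the index type can be all of [V * V]. *)
pose hit (z : V * V) s := ~~ ((z.1 \in X) && (z.2 \in X)) || conn e z.1 s z.2.
have [|||rs [szrs sprs hits]] := @reservoir V (V * V)%type hit J k k0 _ h h V0.
- move=> [x y]; rewrite /hit /=; case: (boolP (_ && _)) => /= [/andP[xX yX]|_].
    by have := conn_count e_sym g0 X4 bigX cutX xX yX; rewrite -JE -kE.
  by rewrite count_predT size_words leq_pmull.
- by rewrite card_prod mulnn; apply: hv1.
- apply: leq_trans hle; rewrite cE.
  have -> : J * (4 * k * (h + h) * J) * (2 * k) = h * (16 * 1 * J ^ 2 * k ^ 2).
    by rewrite -!mulnn; lia.
  rewrite leq_mul2l; apply/orP; right.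
  by apply: leq_mul => //; apply: leq_mul => //; apply: leq_mul.
pose R := [set u | u \in flatten rs].
have hR : 8 * g * #|R| <= #|V|.
  have cR : #|R| <= 4 * k * (h + h) * J.
    rewrite -szrs -(@size_flatten_const _ rs J) => [|s srs].
      by rewrite cardsE card_size.
    by case/andP: sprs => /allP /(_ s srs) /eqP.
  apply: leq_trans (leq_mul (leqnn _) cR) _; apply: leq_trans hle; rewrite cE.
  have -> : 8 * g * (4 * k * (h + h) * J) = h * (64 * g * J * k) by lia.
  rewrite leq_mul2l; apply/orP; right; rewrite -!mulnn.
  have : 64 * g * J * k * 1 <= 64 * g * J * k * (J * k) by rewrite leq_mul2l muln_gt0 J0 k0 orbT.
  lia.
(* Here [m] is the cover size [n / 2 + #|V| / (4 g)] rounded up, at most [2 * #|V|], and [d] is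
   chosen so that [2 g ^ 2 d m] does not exceed [#|V| ^ 2], as [dense_subgraph] requires. *)
pose d := #|V| %/ (4 * g ^ 2).
pose m := (2 * g * n + #|V|) %/ (4 * g) + 1.
pose t := n %/ (2 * l.+1) + 1.
have g2 : 0 < 4 * g ^ 2 by rewrite muln_gt0 expn_gt0 g0.
have d1 : d * (4 * g ^ 2) <= #|V| by apply: leq_trunc_div.
have d2 : #|V| < d.+1 * (4 * g ^ 2) by apply: ltn_ceil.
have m1 : (m - 1) * (4 * g) <= 2 * g * n + #|V| by rewrite /m addnK leq_trunc_div.
have m2 : 2 * g * n + #|V| < m * (4 * g) by rewrite /m addn1 ltn_ceil // muln_gt0.
have m0 : 0 < m by rewrite /m addn1.
have t1 : (t - 1) * (2 * l.+1) <= n by rewrite /t addnK leq_trunc_div.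
have t2 : n < t * (2 * l.+1) by rewrite /t addn1 ltn_ceil.
have t0 : 0 < t by rewrite /t addn1.
clearbody d m t.
have mV : m <= 2 * #|V| by apply: cover_bound m1 m0.
have [] := @disjoint_paths V e side X g n e_sym e_bip g0 bigX robust R l q d m t hR.
- by move: m1 m0; clear; case: m => // m; rewrite subn1 /=; nia.
- by rewrite lt0n; apply: contraTneq d2 => ->; rewrite mul1n -leqNgt; apply: leq_trans hve; clear; lia.
- exact: dense_bound.
- by [].
- by [].
- by [].
- by move: d2 hve; clear; rewrite mulSn; lia.
- by move: m2; clear; lia.
- by move: t1 t0; clear; case: t => // t; rewrite subn1 /=; nia.
move=> ts [szts tsP uts subts].
have tsn : ts != [::] by rewrite -size_eq0 szts -lt0n.
have tsX s : s \in ts -> head x0 s \in X /\ last x0 s \in X.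
  move=> sts; have [szs _] := tsP s sts.
  have subs u : u \in s -> u \in X.
    move=> us; have /subts : u \in flatten ts by apply/flattenP; exists s.
    by rewrite inE => /andP[].
  case: s sts szs subs => [|a s] _ // _ subs /=.
  by rewrite !subs ?mem_head //= mem_last.
have tsP' s : s \in ts -> s != [::] /\ sorted e s.
  move=> sts; have [szs ss] := tsP s sts; split=> //.
  by rewrite -size_eq0 szs doubleS.
have prs : pairwise (fun s t : seq V => ~~ has [in s] t) rs by case/andP: sprs.
have [||p [sp up szp _ _]] := @assemble V e x0 ts rs tsn tsP' uts prs.
- apply/hasPn => u ur; apply/negP => /= /subts; by rewrite !inE ur.
- move=> s s' sts s'ts; have [_ ls] := tsX s sts; have [hs _] := tsX s' s'ts.
  have := hits (last x0 s, head x0 s'); rewrite /hit /= ls hs /=.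
  apply: leq_trans; rewrite szts.
  by apply: tiles_le_hits hvb hgt nV _; rewrite -lE.
exists p; split=> //; apply: leq_trans szp.
rewrite (@size_flatten_const _ ts l.+1.*2) ?szts => [|s /tsP[]//].
by rewrite -mul2n ltnW.
Qed.

(** * Decomposition into cut-dense pieces with small covers *)

Section Partition.
Variables (V : finType) (e : rel V) (g : nat).
Hypothesis e_sym : symmetric e.

Definition crossing (lab : {ffun V -> option V}) : {set V * V} :=
  [set p | e p.1 p.2 & lab p.1 != lab p.2].
Definition together (lab : {ffun V -> option V}) : {set V * V} :=
  [set p | lab p.1 == lab p.2].

(* Take a labelling minimising [g * crossing + together]: giving [U] a fresh label
   cannot decrease this quantity, which is cut-density. *)
Lemma cut_dense_partition : exists lab : {ffun V -> option V},
  g * #|crossing lab| <= #|V| ^ 2 /\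
  forall k, cut_dense e g [set v | lab v == k].
Proof.
pose Phi lab := g * #|crossing lab| + #|together lab|.
have [lab _ min] := @arg_minnP _ [ffun=> None] predT Phi isT.
exists lab; split.
  have := min [ffun=> None] isT; rewrite /Phi.
  have -> : crossing [ffun=> None] = set0 by apply/setP=> p; rewrite !inE !ffunE eqxx andbF.
  rewrite cards0 muln0 add0n => h.
  apply: leq_trans (leq_addr _ _) (leq_trans h _).
  by apply: leq_trans (max_card _) _; rewrite card_prod mulnn.
move=> k; set X := finset _ => U UX.
(* [option V] has one label more than there are vertices, so a fresh one always exists. *)
have [o oP] : exists o, forall v, lab v != o.
  pose I := [set lab v | v : V].
  have : ~~ ([set: option V] \subset I).
    apply/negP => /subset_leq_card; rewrite cardsT card_option leqNgt ltnS.
    by rewrite leq_imset_card.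
  case/subsetPn=> o _ oI; exists o => v; apply: contraNneq oI => <-.
  exact: imset_f.
pose lab' := [ffun v => if v \in U then o else lab v].
set W := X :\: U.
pose sw (p : V * V) := (p.2, p.1).
have sw_inj : injective sw by move=> [a b] [a' b'] [-> ->].
pose E := [set p : V * V | [&& p.1 \in W, p.2 \in U & e p.1 p.2]].
have EE : \sum_(z in W) #|[set u in U | e z u]| = #|E|.
  rewrite -sum1_card (partition_big (fun p : V * V => p.1) [in W]) /=; last first.
    by move=> p; rewrite inE => /and3P[].
  apply: eq_bigr => z zW; rewrite -sum1_card.
  rewrite [RHS](reindex (fun u => (z, u))) /=; last first.
    exists snd => [u _ //|[a b]]; rewrite inE => /andP[_ /eqP /= ->] //.
  by apply: eq_bigl => u; rewrite inE [in RHS]inE /= zW eqxx andbT.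
have XU v : v \in U -> lab v = k.
  by move/(subsetP UX); rewrite inE => /eqP.
have hc : #|crossing lab'| <= #|crossing lab| + (#|E| + #|E|).
  rewrite -[X in _ + (_ + X)](card_imset _ sw_inj).
  apply: leq_trans (leq_trans (leq_card_setU _ _) (leq_add (leqnn _) (leq_card_setU _ _))).
  apply/subset_leq_card/subsetP=> -[a b]; rewrite !inE /= !ffunE => /andP[eab].
  rewrite eab /=; case aU: (a \in U); case bU: (b \in U) => //=.
  - by rewrite eqxx.
  - move=> _; case: eqP => //= lab_eq; apply/imsetP; exists (b, a) => //.
    by rewrite !inE /= aU bU e_sym eab -lab_eq (XU a) ?eqxx.
  - move=> _; case: eqP => //= lab_eq; apply/orP; left.
    by rewrite lab_eq (XU b) ?eqxx.
  - by move=> ->.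
have ht : #|together lab'| + (#|setX U W| + #|setX W U|) <= #|together lab|.
  rewrite -cardsUI [X in _ + (_ + X)]eq_card0 ?addn0 => [|[a b]]; last first.
    by rewrite !inE /=; case: (a \in U); rewrite ?andbF.
  rewrite -cardsUI [X in _ + X]eq_card0 ?addn0 => [|[a b]]; last first.
    rewrite !inE /= !ffunE; case: (a \in U); case: (b \in U); rewrite ?andbF //=.
      by rewrite eq_sym (negPf (oP b)).
    by rewrite (negPf (oP a)).
  apply/subset_leq_card/subsetP=> -[a b]; rewrite !inE /= !ffunE.
  case aU: (a \in U); case bU: (b \in U); rewrite ?andbF ?orbF ?andbT //=.
  - by move=> _; rewrite !XU.
  - by rewrite eq_sym (negPf (oP b)) => /= /eqP ->; rewrite XU.
  - by rewrite (negPf (oP a)) => /= /eqP ->; rewrite XU.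
have := min lab' isT; rewrite /Phi EE !cardsX in ht *.
nia.
Qed.
End Partition.

(** Junk edges cross between pieces or avoid the cover of their piece. A piece with fewer than
    [#|V| / g] vertices has few edges and gets the empty cover; in a larger one the absence of a
    long path yields the cover by [long_path]. *)
Lemma partition_cover (g : nat) : 0 < g -> exists v0, forall (V : finType) (e : rel V)
  (side : V -> bool) (n : nat), v0 <= #|V| ->
  symmetric e -> (forall u w, e u w -> side u != side w) ->
  (forall p, sorted e p -> uniq p -> size p < n) ->
  exists (lab : {ffun V -> option V}) (S : {set V}),
    g * #|[set p : V * V | e p.1 p.2 &
       ~~ ((lab p.1 == lab p.2) && ((p.1 \in S) || (p.2 \in S)))]| <= 2 * #|V| ^ 2 /\
    forall k, 2 * g * #|[set v in S | lab v == k]| <= g * n + #|V|.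
Proof.
move=> g0; have [v0 long] := long_path g0; exists v0.
move=> V e side n hv e_sym e_bip nopath.
have [lab [hcross hcut]] := cut_dense_partition g e_sym.
pose X k := [set v | lab v == k].
have cover k : exists S : {set V}, (2 * g * #|S| <= g * n + #|V|) &&
    (g * #|edges e (X k :\: S)| <= #|V| * #|X k|).
  have [big|small] := leqP #|V| (g * #|X k|); last first.
    exists set0; rewrite cards0 muln0 /= setD0.
    have : #|edges e (X k)| <= #|X k| * #|X k|.
      rewrite -cardsX; apply/subset_leq_card/subsetP=> p; rewrite !inE.
      by case/and3P=> -> ->.
    by move=> h; apply: leq_trans (leq_mul (leqnn g) h) _; rewrite mulnA leq_mul2r ltnW ?orbT.
  apply/existsP; apply: contraT; rewrite negb_exists => /forallP noS.
  have [|p [sp up]] := long V e side (X k) n hv e_sym e_bip big (hcut k).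
  - move=> S hS; have := noS S; rewrite hS /= -ltnNge => h.
    rewrite -mulnn; apply: leq_ltn_trans (leq_mul (leqnn #|V|) big) _.
    rewrite mulnCA -[g ^ 2]mulnn -mulnA ltn_pmul2l //.
  - by rewrite leqNgt nopath.
have /fin_all_exists[S SP] := cover.
exists lab, [set v | v \in S (lab v)]; split; last first.
  move=> k; have /andP[h _] := SP k; apply: leq_trans h.
  rewrite leq_mul2l; apply/orP; right; apply/subset_leq_card/subsetP=> v.
  by rewrite !inE => /andP[+ /eqP <-].
set junk := finset _.
have hj : #|junk| <= #|crossing e lab| + \sum_k #|edges e (X k :\: S k)|.
  rewrite -(cardsID (crossing e lab) junk) leq_add //; first exact/subset_leq_card/subsetIr.
  rewrite -sum1_card (partition_big (fun p : V * V => lab p.1) predT) //=.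
  apply: leq_sum => k _; rewrite sum1_card; apply/subset_leq_card/subsetP=> -[a b].
  move=> /andP[/setDP[]]; rewrite !inE /= => /andP[eab].
  rewrite eab /= negbK => + labeq; rewrite labeq /= negb_or => /andP[aS bS] /eqP <-.
  by rewrite -(eqP labeq) eqxx aS /= andbT; rewrite (eqP labeq) bS.
apply: leq_trans (leq_mul (leqnn g) hj) _; rewrite mulnDr mul2n -addnn leq_add //.
rewrite big_distrr /=; apply: (@leq_trans (\sum_k #|V| * #|X k|)).
  by apply: leq_sum => k _; have /andP[] := SP k.
rewrite -big_distrr /= -mulnn leq_mul2l; apply/orP; right.
rewrite -[leqRHS]cardsT -[leqRHS]sum1_card (partition_big lab predT) //=.
by apply: leq_sum => k _; rewrite sum1dep_card; apply/subset_leq_card/subsetP=> v; rewrite !inE.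
Qed.

(** * Sampling *)

Section RandomSample.
Local Open Scope ring_scope.

Section Sampling.
Variables (R : realFieldType) (O K : finType) (M : nat).
Hypothesis O_gt0 : (0 < #|O|)%N.

Definition deviation (S : {set O}) (f : {ffun 'I_M -> O}) : R :=
  #|[set i | f i \in S]|%:R - M%:R * (#|S|%:R / #|O|%:R).

Lemma sum_deviation S :
  \sum_f deviation S f ^+ 2 <= #|O|%:R ^+ M * M%:R * (#|S|%:R / #|O|%:R).
Proof.
pose N : R := #|O|%:R; pose p : R := #|S|%:R / N.
have N0 : N != 0 by rewrite pnatr_eq0 -lt0n.
pose u (i : 'I_M) (o : O) : R := (o \in S)%:R - p.
have sumS : \sum_o (o \in S)%:R = #|S|%:R :> R.
  by rewrite -sum1_card natr_sum [RHS]big_mkcond; apply: eq_bigr => o _; case: (o \in S).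
have dE f : deviation S f = \sum_i u i (f i).
  rewrite /deviation /u sumrB sumr_const card_ord -[p *+ M]mulr_natl; congr (_ - _).
  rewrite -sum1_card natr_sum big_mkcond; apply: eq_bigr => i _.
  by rewrite inE; case: (f i \in S).
have u0 i : \sum_o u i o = 0.
  by rewrite sumrB sumS sumr_const -[p *+ _]mulr_natr divfK ?subrr.
have u2 (i : 'I_M) : \sum_o u i o ^+ 2 <= #|S|%:R.
  have -> : \sum_o u i o ^+ 2 = #|S|%:R - 2 * p * #|S|%:R + N * p ^+ 2.
    transitivity (\sum_o ((o \in S)%:R - 2 * p * (o \in S)%:R + p ^+ 2)).
      by apply: eq_bigr => o _; rewrite /u; case: (o \in S) => /=; ring.
    by rewrite big_split sumrB -mulr_sumr sumS sumr_const -[p ^+ 2 *+ _]mulr_natl.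
  have -> : #|S|%:R = N * p by rewrite mulrC divfK.
  have : 0 <= N * p ^+ 2 by rewrite mulr_ge0 ?sqr_ge0.
  rewrite expr2; lra.
under eq_bigr => f _ do rewrite dE; rewrite second_moment // card_ord.
case: M u u0 u2 {dE} => [|m] u u0 u2; first by rewrite big_ord0 mulr0 !mulr_ge0 ?exprn_ge0 ?invr_ge0.
apply: (@le_trans _ _ (#|O|%:R ^+ m * (m.+1%:R * #|S|%:R))).
  rewrite ler_wpM2l ?exprn_ge0 //=; apply: le_trans (ler_sum _ (fun i _ => u2 i)) _.
  by rewrite sumr_const card_ord mulr_natl.
rewrite exprSr -/N -/p; have -> : #|S|%:R = N * p by rewrite mulrC divfK.
by rewrite !mulrA (mulrAC _ m.+1%:R).
Qed.

(** The variance for a set is proportional to its size, so the bound does not depend on the number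
    of sets, which will grow with [N]. *)
Lemma sum_deviations (S : K -> {set O}) :
  (\sum_k #|S k| <= #|O|)%N ->
  \sum_f \sum_k deviation (S k) f ^+ 2 <= #|O|%:R ^+ M * M%:R.
Proof.
move=> le; rewrite exchange_big /=.
apply: le_trans (ler_sum _ (fun k _ => sum_deviation (S k))) _.
rewrite -mulr_sumr ler_piMr ?mulr_ge0 ?exprn_ge0 // -mulr_suml ler_pdivrMr ?ltr0n //.
by rewrite mul1r -natr_sum ler_nat.
Qed.
End Sampling.

Definition sample (A B K : finType) M (c : colour A B K) (f : {ffun 'I_M -> A})
    (h : {ffun 'I_M -> B}) : colour 'I_M 'I_M K :=
  Colour (fun i => labA c (f i)) (fun j => labB c (h j))
    [set i | f i \in covA c] [set j | h j \in covB c].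

Lemma sum_junk (R : realFieldType) (A B : finType) M (J : {set A * B}) :
  \sum_(f : {ffun 'I_M -> A}) \sum_(h : {ffun 'I_M -> B})
     \sum_i \sum_j ((f i, h j) \in J)%:R =
  M%:R ^+ 2 * #|A|%:R ^+ M.-1 * #|B|%:R ^+ M.-1 * #|J|%:R :> R.
Proof.
have cst (x : R) : M%:R * x = \sum_(j < M) x.
  by rewrite sumr_const card_ord mulr_natl.
have inner (f : {ffun 'I_M -> A}) i j :
  \sum_(h : {ffun 'I_M -> B}) ((f i, h j) \in J)%:R =
  #|B|%:R ^+ M.-1 * \sum_y ((f i, y) \in J)%:R :> R.
  by have := sum_ffun1 j (fun y => ((f i, y) \in J)%:R : R); rewrite card_ord.
transitivity (\sum_(f : {ffun 'I_M -> A}) \sum_(i < M) \sum_(j < M)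
  (#|B|%:R ^+ M.-1 * \sum_y ((f i, y) \in J)%:R) : R).
  apply: eq_bigr => f _; rewrite [LHS]exchange_big; apply: eq_bigr => i _.
  by rewrite [LHS]exchange_big; apply: eq_bigr => j _; apply: inner.
rewrite exchange_big /=.
transitivity (\sum_(i < M) M%:R * (#|B|%:R ^+ M.-1 * (#|A|%:R ^+ M.-1 * #|J|%:R)) : R).
  apply: eq_bigr => i _; rewrite exchange_big /= cst.
  apply: eq_bigr => j _; rewrite -mulr_sumr; congr (_ * _).
  have := sum_ffun1 i (fun x => \sum_y ((x, y) \in J)%:R : R); rewrite card_ord => ->.
  congr (_ * _); rewrite pair_big -sum1_card natr_sum [RHS]big_mkcond /=.
  by apply: eq_bigr => -[x y] _ /=; case: (_ \in J).
rewrite -cst; ring.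
Qed.

(* A random [M x M] sample contains no junk pair, and in it all covers have
   nearly their expected size, so [not_covered_by] applies to the sample. *)
Lemma no_small_covers (R : realFieldType) (K : finType) (k N n s q : nat) (r b g : colour 'I_N 'I_N K) :
  s = (576 * (3 * k + 1) ^ 2)%N -> q = (48 * (3 * s).+1 ^ 2)%N -> (0 < N)%N ->
  ((3 * k + 1) * n <= 2 * k * N)%N ->
  (forall c, [\/ c = r, c = b | c = g] -> forall l,
     2 * q * (#|strA c l| + #|strB c l|) <= q * n + 2 * N)%N ->
  (q * #|[set p : 'I_N * 'I_N | ~~ [|| joined r p.1 p.2, joined b p.1 p.2
      | joined g p.1 p.2]]| <= 24 * N ^ 2)%N -> False.
Proof.
move=> sE qE N0 hn hload; set J := finset _ => hJ.
have [M MS] : exists M, M = (3 * s).+1 by eexists.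
rewrite -MS in qE.
have [a aD] : exists a : R, a = (3 * k + 1)%:R by eexists.
(* The expected cover density will be at most [(k + 1/6) / a]; two deviations of [eta] raise it to
   at most [(k + 1/3) / a = 1/3]. The size [M > 1728 a ^ 2] ensures [12 M < Q] below. *)
have [eta etaE] : exists eta : R, eta = (12 * a)^-1 by eexists.
have NM : #|{ffun 'I_M -> 'I_N}| = (N ^ M)%N by rewrite card_ffun !card_ord.
pose dA (c : colour 'I_N 'I_N K) (f : {ffun 'I_M -> 'I_N}) : R := \sum_l deviation R (strA c l) f ^+ 2.
pose dB (c : colour 'I_N 'I_N K) (f : {ffun 'I_M -> 'I_N}) : R := \sum_l deviation R (strB c l) f ^+ 2.
have N0' : (0 < #|'I_N|)%N by rewrite card_ord.
have partA c : \sum_(f : {ffun 'I_M -> 'I_N}) dA c f <= N%:R ^+ M * M%:R.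
  rewrite -[N in leRHS]card_ord; apply: sum_deviations => //.
  rewrite -[leqRHS]cardsT -[leqRHS]sum1_card (partition_big (labA c) predT) //=.
  apply: leq_sum => l _; rewrite sum1dep_card; apply/subset_leq_card/subsetP=> x.
  by rewrite !inE => /andP[_ ->].
have partB c : \sum_(f : {ffun 'I_M -> 'I_N}) dB c f <= N%:R ^+ M * M%:R.
  rewrite -[N in leRHS]card_ord; apply: sum_deviations => //.
  rewrite -[leqRHS]cardsT -[leqRHS]sum1_card (partition_big (labB c) predT) //=.
  apply: leq_sum => l _; rewrite sum1dep_card; apply/subset_leq_card/subsetP=> x.
  by rewrite !inE => /andP[_ ->].
pose Q : R := (eta * M%:R) ^+ 2.
pose junk (f h : {ffun 'I_M -> 'I_N}) : R := \sum_i \sum_j ((f i, h j) \in J)%:R.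
(* [Psi < Q] forces every deviation below [eta M] and the integral junk count to be 0. On average
   the junk term is at most [Q / 2] by the choice of [q], and the six deviation terms are at most
   [6 M], less than [Q / 2]. *)
pose Psi f h := junk f h * Q + (dA r f + dA b f + dA g f) + (dB r h + dB b h + dB g h).
have dA0 c f : 0 <= dA c f by apply: sumr_ge0 => l _; apply: sqr_ge0.
have dB0 c f : 0 <= dB c f by apply: sumr_ge0 => l _; apply: sqr_ge0.
have junk0 f h : 0 <= junk f h by do 2!(apply: sumr_ge0 => ? _).
have Q0 : 0 <= Q by apply: sqr_ge0.
have a0 : 0 < a by rewrite aD ltr0n addn1.
have Nr : 0 < (N%:R : R) by rewrite ltr0n.
have M0 : (0 < M)%N by rewrite MS.
have Mr : 0 < (M%:R : R) by rewrite ltr0n.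
have ME : M%:R = 1728 * a ^+ 2 + 1 :> R.
  rewrite MS sE aD -natr1 !natrM; ring.
have QE : Q = M%:R * (M%:R / (144 * a ^+ 2)).
  rewrite /Q etaE; move: (M%:R : R) => y; field; by rewrite gt_eqF.
have J2 : 2 * M%:R ^+ 2 * #|J|%:R <= N%:R ^+ 2 :> R.
  rewrite -!natrX -!natrM ler_nat; move: hJ; rewrite qE; move: (M ^ 2)%N (N ^ 2)%N #|J| => x y z.
  by clear; lia.
have [f [h small]] : exists f h, Psi f h < Q.
  pose m : R := N%:R ^+ M.-1.
  have mE : N%:R ^+ M = N%:R * m by rewrite /m -[in LHS](prednK M0) exprS.
  pose c : R := M%:R ^+ 2 * #|J|%:R / N%:R ^+ 2 * Q + 6 * M%:R.
  have cQ : c < Q.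
    have h1 : M%:R ^+ 2 * #|J|%:R / N%:R ^+ 2 <= 2^-1 :> R.
      have N2 : 0 < N%:R ^+ 2 :> R by rewrite exprn_gt0.
      by rewrite ler_pdivrMr //; lra.
    have h2 : M%:R ^+ 2 * #|J|%:R / N%:R ^+ 2 * Q <= 2^-1 * Q by rewrite ler_wpM2r.
    have h3 : 12 * M%:R < Q.
      rewrite QE mulrC ltr_pM2l // ltr_pdivlMr ?mulr_gt0 ?exprn_gt0 // ME.
      by move: (a ^+ 2) => y; lra.
    rewrite /c; move: h2 h3; move: (_ / _ * Q) => y; lra.
  have [||[f h] /= hfh] := @exists_le_avg R ({ffun 'I_M -> 'I_N} * {ffun 'I_M -> 'I_N})%type
    (fun p => Psi p.1 p.2) c.
  - by rewrite card_prod NM muln_gt0 expn_gt0 N0.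
  - rewrite -(pair_bigA _ Psi) /= card_prod NM natrM natrX.
    have -> : \sum_f \sum_h Psi f h = Q * (\sum_f \sum_h junk f h) +
       N%:R ^+ M * (\sum_f (dA r f + dA b f + dA g f)) +
       N%:R ^+ M * (\sum_h (dB r h + dB b h + dB g h)).
      rewrite mulr_sumr [X in _ + X + _]mulr_sumr -big_split /=.
      have cf (x : R) : N%:R ^+ M * x = \sum_(f : {ffun 'I_M -> 'I_N}) x.
        by rewrite sumr_const NM -[RHS]mulr_natl natrX.
      rewrite cf -big_split /=; apply: eq_bigr => f _.
      rewrite cf mulr_sumr -!big_split /=; apply: eq_bigr => h _.
      by rewrite /Psi [junk f h * Q]mulrC /dA !big_split.
    rewrite sum_junk !card_ord -/m.
    have := partA r; have := partA b; have := partA g.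
    have := partB r; have := partB b; have := partB g.
    rewrite !big_split /=; move: (\sum_f dA r f) (\sum_f dA b f) (\sum_f dA g f)
      (\sum_f dB r f) (\sum_f dB b f) (\sum_f dB g f) => x1 x2 x3 y1 y2 y3 h1 h2 h3 h4 h5 h6.
    have P0 : 0 <= (N%:R ^+ M : R) by rewrite exprn_ge0.
    have hx : N%:R ^+ M * (x1 + x2 + x3) <= N%:R ^+ M * (3 * (N%:R ^+ M * M%:R)).
      by apply: ler_wpM2l => //; lra.
    have hy : N%:R ^+ M * (y1 + y2 + y3) <= N%:R ^+ M * (3 * (N%:R ^+ M * M%:R)).
      by apply: ler_wpM2l => //; lra.
    apply: le_trans (lerD (lerD (lexx _) hx) hy) _.
    rewrite le_eqVlt; apply/orP; left; apply/eqP; rewrite /c mE.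
    by field; rewrite gt_eqF.
  by exists f, h; apply: le_lt_trans hfh cQ.
have dAs c : [\/ c = r, c = b | c = g] -> dA c f <= Psi f h.
  have := dA0 r f; have := dA0 b f; have := dA0 g f; have := dB0 r h; have := dB0 b h.
  have := dB0 g h; have := mulr_ge0 (junk0 f h) Q0; rewrite /Psi.
  by move=> ? ? ? ? ? ? ? [->|->|->]; lra.
have dBs c : [\/ c = r, c = b | c = g] -> dB c h <= Psi f h.
  have := dA0 r f; have := dA0 b f; have := dA0 g f; have := dB0 r h; have := dB0 b h.
  have := dB0 g h; have := mulr_ge0 (junk0 f h) Q0; rewrite /Psi.
  by move=> ? ? ? ? ? ? ? [->|->|->]; lra.
have nojunk i j : (f i, h j) \notin J.
  apply: contraTN small => ijJ; rewrite -leNgt.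
  have j1 : 1 <= junk f h.
    rewrite /junk (bigD1 i) //= (bigD1 j) //= ijJ -addrA lerDl addr_ge0 //.
      by apply: sumr_ge0.
    by do 2!(apply: sumr_ge0 => ? _).
  have : Q <= junk f h * Q by rewrite ler_peMl.
  have := dA0 r f; have := dA0 b f; have := dA0 g f; have := dB0 r h; have := dB0 b h.
  have := dB0 g h; rewrite /Psi; lra.
have etaM : 0 <= eta * M%:R by rewrite mulr_ge0 // etaE invr_ge0 mulr_ge0 // ltW.
have sq (x : R) : x ^+ 2 < Q -> `|x| < eta * M%:R.
  by rewrite -(real_normK (num_real x)) /Q ltr_pXn2r ?nnegrE.
have devA c l : [\/ c = r, c = b | c = g] -> `|deviation R (strA c l) f| < eta * M%:R.
  move=> hc; apply: sq; apply: le_lt_trans small; apply: le_trans (dAs c hc).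
  by rewrite /dA (bigD1 l) //= lerDl; apply: sumr_ge0 => ? _; apply: sqr_ge0.
have devB c l : [\/ c = r, c = b | c = g] -> `|deviation R (strB c l) h| < eta * M%:R.
  move=> hc; apply: sq; apply: le_lt_trans small; apply: le_trans (dBs c hc).
  by rewrite /dB (bigD1 l) //= lerDl; apply: sumr_ge0 => ? _; apply: sqr_ge0.
apply: (@not_covered_by 'I_M 'I_M K s (sample r f h) (sample b f h) (sample g f h)).
split; rewrite ?card_ord ?MS //; last first.
  by move=> i j; have := nojunk i j; rewrite inE negbK /joined /= !inE.
suff main c l : [\/ c = r, c = b | c = g] ->
    (#|strA (sample c f h) l| + #|strB (sample c f h) l| <= s)%N.
  by move=> c [->|->|->] l; apply: main; [apply: Or31|apply: Or32|apply: Or33].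
move=> hc; have := devA c l hc; have := devB c l hc; have := hload c hc l.
rewrite /deviation !card_ord.
have -> : [set i | f i \in strA c l] = strA (sample c f h) l by apply/setP=> i; rewrite !inE.
have -> : [set i | h i \in strB c l] = strB (sample c f h) l by apply/setP=> i; rewrite !inE.
set LA := #|strA (sample _ _ _) _|; set LB := #|strB (sample _ _ _) _|.
set uA := #|strA c l|; set uB := #|strB c l|.
rewrite -(ler_nat R) !(natrM, natrD) => hu.
rewrite !ltr_norml => /andP[_ hB] /andP[_ hA].
pose x : R := (uA%:R + uB%:R) / N%:R.
have q0 : 0 < (q%:R : R) by rewrite ltr0n qE MS.
have uE : uA%:R + uB%:R = x * N%:R by rewrite /x divfK // gt_eqF.
have hn' : a * n%:R <= 2 * k%:R * N%:R by rewrite aD -!natrM ler_nat.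
have aE : a = 3 * k%:R + 1 by rewrite aD natrD natrM.
(* This limits the share of the error [1 / q] of the partition to [1 / (6 a)]. *)
have q6 : 6 * a <= q%:R.
  rewrite aD -natrM ler_nat qE.
  have : (3 * k + 1 <= M)%N by rewrite MS sE -mulnn; clear; nia.
  by rewrite -mulnn; clear; nia.
have hx : a * x <= k%:R + 6^-1.
  have h1 : 2 * q%:R * (a * x) * N%:R <= (2 * q%:R * k%:R + 2 * a) * N%:R.
    have : a * (2 * q%:R * (uA%:R + uB%:R)) <= a * (q%:R * n%:R + 2 * N%:R).
      by rewrite ler_wpM2l // ltW.
    have : q%:R * (a * n%:R) <= q%:R * (2 * k%:R * N%:R) by rewrite ler_wpM2l // ltW.
    rewrite uE; lra.
  rewrite ler_pM2r // in h1.
  rewrite -(ler_pM2l q0); lra.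
have hsum : LA%:R + LB%:R <= M%:R * (x + 2 * eta).
  have : M%:R * (uA%:R / N%:R) + M%:R * (uB%:R / N%:R) = M%:R * x.
    by rewrite -mulrDr -mulrDl.
  lra.
have ea : a * eta = 12^-1 by rewrite etaE; field; rewrite gt_eqF.
have h3 : 3 * (LA%:R + LB%:R) <= M%:R :> R.
  rewrite -(ler_pM2l a0); apply: (@le_trans _ _ (3 * (M%:R * (a * x + 2 * (a * eta))))).
    have : a * (LA%:R + LB%:R) <= a * (M%:R * (x + 2 * eta)) by rewrite ler_wpM2l // ltW.
    lra.
  have : M%:R * (a * x + 2 * (a * eta)) <= M%:R * (a / 3).
    by rewrite ler_wpM2l ?ler0n // ea; move: hx aE; lra.
  lra.
have : (3 * (LA + LB) <= M)%N by rewrite -(ler_nat R) natrM natrD.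
by rewrite MS; clear; lia.
Qed.

End RandomSample.

(** * Bounds on the Ramsey number *)

Lemma path_copy (G : sgraph) n (p : seq G) (x0 : G) :
  sorted (@edge G) p -> uniq p -> n <= size p -> contains_copy G (path_graph n).
Proof.
move=> sp up le; apply/existsP; exists [ffun i : 'I_n => nth x0 p i].
have lt (i : 'I_n) : i < size p by apply: leq_trans le.
apply/andP; split.
  by apply/injectiveP => i j; rewrite !ffunE => /eqP; rewrite nth_uniq // => /eqP/val_inj.
have step (i j : 'I_n) : i.+1 = j -> edge (nth x0 p i) (nth x0 p j).
  by move=> ij; rewrite -ij; apply: (sortedP x0 sp); rewrite ij.
apply/forallP => i; apply/forallP => j; apply/implyP; rewrite !ffunE.
by case/orP=> /eqP ij; [|rewrite edge_sym]; apply: step.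
Qed.

(** The hypothesis reads [N / n >= 3/2 + 1/(2 k)]; the term [1/(2 k)] pays for all losses. *)
Lemma bip_arrows_path (k : nat) : exists N0, forall N n, N0 <= N ->
  (3 * k + 1) * n <= 2 * k * N -> bip_arrows 3 (path_graph n) N.
Proof.
have [s sE] : exists s, s = 576 * (3 * k + 1) ^ 2 by eexists.
have [q qE] : exists q, q = 48 * (3 * s).+1 ^ 2 by eexists.
have q0 : 0 < q by rewrite qE muln_gt0 expn_gt0.
have [v0 hv0] := partition_cover q0.
exists v0.+1 => N n hN hn.
have N0 : 0 < N by apply: leq_trans hN.
apply/forallP => c; apply: contraT; rewrite negb_exists => /forallP nocopy.
pose V : finType := ('I_N + 'I_N)%type.
have cV : #|V| = 2 * N by rewrite card_sum !card_ord mul2n addnn.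
pose side (v : V) := if v is inl _ then true else false.
have e_bip a u w : colour_edge c a u w -> side u != side w by case: u; case: w.
have nopath a (p : seq V) : sorted (colour_edge c a) p -> uniq p -> size p < n.
  move=> sp up; rewrite ltnNge; apply: contraNN (nocopy a) => le.
  exact: (@path_copy (colour_class c a) n p (inl (Ordinal N0))).
have hV : v0 <= #|V| by rewrite cV; lia.
have := fun a => hv0 V (colour_edge c a) side n hV (colour_edge_sym c a) (e_bip a) (nopath a).
case/fin_all_exists => lab /fin_all_exists [S labS].
pose col (a : 'I_3) : colour 'I_N 'I_N (option V) :=
  Colour (fun x => lab a (inl x)) (fun y => lab a (inr y))
    [set x | inl x \in S a] [set y | inr y \in S a].
have load a l : 2 * q * (#|strA (col a) l| + #|strB (col a) l|) <= q * n + 2 * N.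
  have [_ /(_ l)] := labS a; rewrite cV; apply: leq_trans.
  rewrite leq_mul2l; apply/orP; right.
  pose iA (x : 'I_N) : V := inl x; pose iB (x : 'I_N) : V := inr x.
  have iA_inj : injective iA by move=> ? ? [].
  have iB_inj : injective iB by move=> ? ? [].
  rewrite -(card_imset (strA (col a) l) iA_inj) -(card_imset (strB (col a) l) iB_inj).
  rewrite -cardsUI [X in _ + X]eq_card0 ?addn0 => [|v]; last first.
    by rewrite inE; apply/negP => /andP[/imsetP[x _ ->] /imsetP[]].
  apply/subset_leq_card/subsetP=> v; rewrite !inE.
  by case/orP=> /imsetP[x + ->]; rewrite !inE.
pose a0 : 'I_3 := inord 0; pose a1 : 'I_3 := inord 1; pose a2 : 'I_3 := inord 2.
apply/negPn/negP => _.
apply: (no_small_covers rat (r := col a0) (b := col a1) (g := col a2) sE qE N0 hn).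
  by move=> d [->|->|->] l; apply: load.
set J := finset _.
pose junk a := [set p : V * V | colour_edge c a p.1 p.2 &
       ~~ ((lab a p.1 == lab a p.2) && ((p.1 \in S a) || (p.2 \in S a)))].
(* A pair joined in no colour is in particular not joined in its own colour, so it is junk for that
   colour. *)
have cJ : #|J| <= \sum_(a < 3) #|junk a|.
  rewrite -sum1_card (partition_big c predT) //=; apply: leq_sum => a _.
  rewrite sum1dep_card.
  pose i2 (p : 'I_N * 'I_N) : V * V := (inl p.1, inr p.2).
  have i2_inj : injective i2 by move=> [x y] [x' y'] [-> ->].
  rewrite -(card_imset _ i2_inj); apply/subset_leq_card/subsetP => _ /imsetP[[x y] + ->].
  rewrite !inE /= => /andP[nj /eqP cxy]; rewrite cxy eqxx /=.
  have : ~~ joined (col a) x y.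
    apply: contra nj => ja.
    have : [\/ a = a0, a = a1 | a = a2].
      case: a {cxy} ja => -[|[|[|//]]] i _; [apply: Or31|apply: Or32|apply: Or33];
      by apply: val_inj; rewrite /= inordK.
    by case=> <-; rewrite ja ?orbT.
  by rewrite /joined /= !inE.
apply: leq_trans (leq_mul (leqnn q) cJ) _; rewrite big_distrr /=.
apply: (@leq_trans (\sum_(a < 3) 2 * #|V| ^ 2)).
  by apply: leq_sum => a _; have [] := labS a.
by rewrite sum_nat_const card_ord cV -!mulnn; lia.
Qed.

Lemma bip_ramsey_path_upper (n N : nat) : bip_arrows 3 (path_graph n) N ->
  bip_ramsey 3 (path_graph n) <= N.
Proof. by move=> h; rewrite /bip_ramsey; case: ex_minnP => m _; apply. Qed.

(** A path on [2 k + 2] vertices has [k + 1] disjoint edges, and in one colour each needs its own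
    left vertex in a block of [k]. *)
Lemma bip_ramsey_path_lower (k n : nat) : 2 * k + 2 <= n ->
  3 * k < bip_ramsey 3 (path_graph n).
Proof.
move=> kn; rewrite /bip_ramsey; case: ex_minnP => N arrows _.
rewrite ltnNge; apply/negP => Nk.
pose c : bip_colouring 3 N := [ffun p : 'I_N * 'I_N => inord ((p.1 : 'I_N) %/ k)].
have /existsP[a /existsP[f /andP[/injectiveP f_inj /forallP fP]]] := forallP arrows c.
pose blk := [set x : 'I_N | x %/ k == a].
(* For [k = 0] also [N = 0], so a vertex [x] witnesses that [k] is positive. *)
have k0 (x : 'I_N) : 0 < k by have := ltn_ord x; lia.
have blkE (x y : 'I_N) : c (x, y) == a -> x \in blk.
  rewrite ffunE inE /= => /eqP <-; rewrite inordK // ltn_divLR ?(k0 x) //.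
  exact: leq_trans (ltn_ord x) Nk.
have cblk : #|blk| <= k.
  have [k00|kn0] := posnP k.
    by rewrite eq_card0 // => x; have := k0 x; rewrite k00.
  rewrite -[k in leqRHS]card_ord.
  have inj : {in blk &, injective (fun x : 'I_N => Ordinal (ltn_pmod x kn0))}.
    move=> x y; rewrite !inE => /eqP ex /eqP ey [e]; apply: val_inj => /=.
    by rewrite (divn_eq x k) (divn_eq y k) ex ey e.
  by rewrite -(card_in_imset inj) max_card.
have lt0 (j : 'I_k.+1) : 2 * j < n by have := ltn_ord j; lia.
have lt1 (j : 'I_k.+1) : (2 * j).+1 < n by have := ltn_ord j; lia.
pose u j : 'I_n := Ordinal (lt0 j); pose w j : 'I_n := Ordinal (lt1 j).
have pick (j : 'I_k.+1) : exists x, x \in blk /\ (f (u j) = inl x \/ f (w j) = inl x).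
  have := implyP (forallP (fP (u j)) (w j)); rewrite /= /path_edge /= eqxx => /(_ isT).
  case: (f (u j)) => x; case: (f (w j)) => y //= cxy.
    by exists x; split; [exact: blkE cxy|left].
  by exists y; split; [exact: blkE cxy|right].
have /fin_all_exists[x xP] := pick.
have x_inj : injective x.
  move=> i j exy; have [_ hi] := xP i; have [_ hj] := xP j; rewrite exy in hi.
  apply: val_inj => /=.
  by case: hi hj => ei [] ej; rewrite -ej in ei; have := congr1 val (f_inj _ _ ei) => /=; lia.
have : #|[set x j | j : 'I_k.+1]| <= #|blk|.
  by apply/subset_leq_card/subsetP=> _ /imsetP[j _ ->]; have [] := xP j.
by rewrite card_imset // card_ord leqNgt ltnS cblk.
Qed.

Lemma bip_ramsey_path_bounds (k : nat) : (0 < k)%N -> exists n0, forall n, (n0 <= n)%N ->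
  (3 * n <= 2 * bip_ramsey 3 (path_graph n) + 7)%N /\
  (2 * k * bip_ramsey 3 (path_graph n) <= (3 * k + 1) * n + 2 * k)%N.
Proof.
move=> k0; have [N0 hN] := bip_arrows_path k; exists (N0 + 2)%N => n hn; split.
  (* The 7 is the rounding for odd [n]: with [n = 2 j + 3] the bound [3 j + 1] gives
     [3 n = 2 (3 j + 1) + 7]. *)
  have le : (2 * ((n - 2) %/ 2) + 2 <= n)%N by lia.
  by have := bip_ramsey_path_lower le; lia.
pose N := ((3 * k + 1) * n %/ (2 * k)).+1.
have k2 : (0 < 2 * k)%N by lia.
have N1 : (2 * k * N <= (3 * k + 1) * n + 2 * k)%N.
  by rewrite /N mulnS addnC leq_add2r mulnC leq_trunc_div.
have N2 : ((3 * k + 1) * n < 2 * k * N)%N.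
  by rewrite (mulnC (2 * k)%N); apply: div.ltn_ceil.
apply: leq_trans N1; rewrite leq_mul2l; apply/orP; right.
apply: bip_ramsey_path_upper; apply: hN; last exact: ltnW.
have : (2 * k * n < 2 * k * N)%N by apply: leq_ltn_trans N2; lia.
by rewrite ltn_pmul2l //; lia.
Qed.

Unset Implicit Arguments.

From mathcomp Require Import all_classical all_reals.
From mathcomp Require Import topology normedtype sequences.
Import numFieldNormedType.Exports.
Local Open Scope classical_set_scope.
Local Open Scope ring_scope.

Theorem corollary2 (R : realType) :
  (bip_ramsey 3 (path_graph n))%:R / n%:R @[n --> \oo] --> (3 / 2 : R).
Proof.
apply/cvgrPdist_le => /= e e0.
pose k := (Num.truncn e^-1).+1.
have ke : k%:R^-1 <= e.
  by rewrite -[leRHS]invrK lef_pV2 ?posrE ?invr_gt0 ?ltr0n // ltW // truncnS_gt.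
have [n0 hn0] := @bip_ramsey_path_bounds k isT.
(* The errors are at most [7 / (2 n)] below and [1 / (2 k) + 1 / n] above; with [n] at least [4 k]
   both are at most [1 / k]. *)
exists (n0 + 4 * k + 1)%N => // n /= hn.
have [h1 h2] : (3 * n <= 2 * bip_ramsey 3 (path_graph n) + 7)%N /\
  (2 * k * bip_ramsey 3 (path_graph n) <= (3 * k + 1) * n + 2 * k)%N.
  by apply: hn0; lia.
have kn : (4 * k <= n)%N by lia.
have n1 : (0 < n)%N by lia.
move: (bip_ramsey _ _) h1 h2 => r.
rewrite -!(ler_nat R) !(natrD, natrM) => h1 h2.
have nr : 0 < n%:R :> R by rewrite ltr0n.
have kr : 0 < k%:R :> R by rewrite ltr0n.
apply: le_trans ke.
rewrite -(ler_nat R) natrM in kn.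
rewrite ler_norml; apply/andP; split.
  rewrite lerBrDr addrC -lerBrDr opprK.
  rewrite ler_pdivrMr //.
  rewrite -(ler_pM2l kr) [leRHS]mulrA mulrDr mulfV ?gt_eqF //.
  lra.
rewrite lerBlDr -lerBlDl ler_pdivlMr //.
rewrite -(ler_pM2l kr) [leLHS]mulrA mulrBr mulfV ?gt_eqF //.
nra.
Qed.
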